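(* Let $n\ge2$, let $(\mathcal{N},[\cdot,\ldots,\cdot])$ and $(\mathcal{N}',[\cdot,\ldots,\cdot]')$ be two $n$-Lie algebras over $\mathbb{K}$ and let $\phi:\mathcal{N}\to\mathcal{N}'$ be an $n$-Lie algebra morphism. For $m\ge0$ let $$C^m(\phi,\phi)=C^m(\mathcal{N},\mathcal{N})\oplus C^m(\mathcal{N}',\mathcal{N}')\oplus C^{m-1}(\mathcal{N},\mathcal{N}')$$ (with $C^{-1}(\mathcal{N},\mathcal{N}')=0$) and let $\delta^{m+1}:C^m(\phi,\phi)\to C^{m+1}(\phi,\phi)$ be defined by $$\delta^{m+1}(\varphi_1,\varphi_2,\varphi_3)=\bigl(\delta^{m+1}\varphi_1,\ \delta^{m+1}\varphi_2,\ \delta^m\varphi_3+(-1)^m(\phi\circ\varphi_1-\varphi_2\circ(\bar\phi^{\otimes m}\wedge\phi))\bigr).$$ Then $\delta^{m+2}\circ\delta^{m+1}=0$ for all $m\ge 0$. Hence $(C^*(\phi,\phi),\delta)$ is a cochain complex.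
   Context: $\mathbb{K}$ is an algebraically closed field of characteristic $0$; all vector spaces are over $\mathbb{K}$. An $n$-Lie algebra is a vector space $\mathcal{N}$ with a skew-symmetric $n$-linear bracket satisfying the Nambu identity $[x_1,\ldots,x_{n-1},[y_1,\ldots,y_n]]=\sum_{i=1}^n[y_1,\ldots,y_{i-1},[x_1,\ldots,x_{n-1},y_i],y_{i+1},\ldots,y_n]$. A morphism of $n$-Lie algebras is a linear map $f$ with $f([x_1,\ldots,x_n])=[f(x_1),\ldots,f(x_n)]'$. Put $\mathcal{L}(\mathcal{N})=\wedge^{n-1}\mathcal{N}$. For $x=x^1\wedge\cdots\wedge x^{n-1}$ and $y=y^1\wedge\cdots\wedge y^{n-1}$ in $\mathcal{L}(\mathcal{N})$: $ad(x).z=[x^1,\ldots,x^{n-1},z]$ for $z\in\mathcal{N}$; $L'(x).w=[\phi(x^1),\ldots,\phi(x^{n-1}),w]'$ for $w\in\mathcal{N}'$; $[x,y]=\sum_{i=1}^{n-1}y^1\wedge\cdots\wedge(ad(x).y^i)\wedge\cdots\wedge y^{n-1}$. $C^m(\mathcal{N},\mathcal{N}')$ is the space of linear maps $f:\otimes^m\mathcal{L}(\mathcal{N})\wedge\mathcal{N}\to\mathcal{N}'$: for $m=0$, linear maps $\mathcal{N}\to\mathcal{N}'$; for $m\ge1$, linear maps $f(x_1,\ldots,x_m,z)$ on $\mathcal{L}(\mathcal{N})^{\otimes m}\otimes\mathcal{N}$ that are skew-symmetric in the $n$ arguments $x_m^1,\ldots,x_m^{n-1},z$. The operator $\delta^{m+1}:C^m(\mathcal{N},\mathcal{N}')\to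 C^{m+1}(\mathcal{N},\mathcal{N}')$ ($m\ge0$) is $$\begin{aligned}\delta^{m+1}f(x_1,\ldots,x_{m+1},z)=&\sum_{1\le i<j\le m+1}(-1)^i f(x_1,\ldots,\widehat{x}_i,\ldots,x_{j-1},[x_i,x_j],\ldots,x_{m+1},z)\\&+\sum_{i=1}^{m+1}(-1)^i f(x_1,\ldots,\widehat{x}_i,\ldots,x_{m+1},ad(x_i).z)\\&+\sum_{i=1}^{m+1}(-1)^{i+1}L'(x_i).f(x_1,\ldots,\widehat{x}_i,\ldots,x_{m+1},z)\\&+(-1)^m\sum_{i=1}^{n-1}[\phi(x_{m+1}^1),\ldots,f(x_1,\ldots,x_m,x_{m+1}^i),\ldots,\phi(x_{m+1}^{n-1}),\phi(z)]'\end{aligned}$$ (with $f(x_1,\ldots,x_m,x_{m+1}^i)$ in the $i$-th slot), and $\delta^0=0$ on $C^{-1}=0$. The complexes $C^*(\mathcal{N},\mathcal{N})$ and $C^*(\mathcal{N}',\mathcal{N}')$ are those obtained from the same formulas with target algebra equal to the source and $\phi$ replaced by the identity. $\bar\phi:\mathcal{L}(\mathcal{N})\to\mathcal{L}(\mathcal{N}')$ is $\bar\phi(x^1\wedge\cdots\wedge x^{n-1})=\phi(x^1)\wedge\cdots\wedge\phi(x^{n-1})$, and $(\bar\phi^{\otimes m}\wedge\phi)(x_1,\ldots,x_m,z)=(\bar\phi(x_1),\ldots,\bar\phi(x_m),\phi(z))$. *)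

(* Defs.v *)
From HB Require Import structures.
From mathcomp Require Import all_boot perm all_algebra.
From mathcomp Require Import boolp functions.

Set Implicit Arguments.
Unset Strict Implicit.
Unset Printing Implicit Defensive.

Import GRing.Theory.
Local Open Scope ring_scope.
Local Open Scope quotient_scope.

Definition upd (T : Type) (k : nat) (v : {ffun 'I_k -> T}) (i : 'I_k) (x : T) :
    {ffun 'I_k -> T} :=
  [ffun j => if j == i then x else v j].

(* (v_1, ..., v_{n-1}, z), for n > 0. *)
Definition snoc (T : Type) (n : nat) (v : {ffun 'I_n.-1 -> T}) (z : T) :
    {ffun 'I_n -> T} :=
  [ffun i => if insub (val i) is Some j then v j else z].

(* (x_1, ..., x_m) without its i-th entry. *)
Definition del (T : Type) (m : nat) (i : 'I_m.+1) (x : {ffun 'I_m.+1 -> T}) :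
    {ffun 'I_m -> T} :=
  [ffun j => x (lift i j)].

Definition map_ffun (T U : Type) (g : T -> U) (k : nat) (v : {ffun 'I_k -> T}) :
    {ffun 'I_k -> U} :=
  [ffun i => g (v i)].

Definition multilinear_map (K : pzRingType) (V W : lmodType K) (k : nat)
    (g : {ffun 'I_k -> V} -> W) : Prop :=
  forall (v : {ffun 'I_k -> V}) (i : 'I_k) (a : K) (x y : V),
    g (upd v i (a *: x + y)) = a *: g (upd v i x) + g (upd v i y).

Definition skew_symmetric_map (K : pzRingType) (V W : lmodType K) (k : nat)
    (g : {ffun 'I_k -> V} -> W) : Prop :=
  forall (s : 'S_k) (v : {ffun 'I_k -> V}),
    g [ffun i => v (s i)] = (-1) ^+ s *: g v.

Definition alternating_map (K : pzRingType) (V W : lmodType K) (k : nat)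
    (g : {ffun 'I_k -> V} -> W) : Prop :=
  forall (v : {ffun 'I_k -> V}) (i j : 'I_k), i != j -> v i = v j -> g v = 0.

(* Exterior powers by generators and relations: a list of pairs (a, v) stands
   for the formal linear combination of the decomposables v_1 /\ ... /\ v_k
   with coefficients a. *)
Section ExteriorPower.
Variables (K : fieldType) (V : lmodType K) (k : nat).

Local Notation formal := (seq (K * {ffun 'I_k -> V})).

Definition fscale (a : K) (s : formal) : formal :=
  [seq (a * p.1, p.2) | p <- s].

Inductive ext_rel : formal -> formal -> Prop :=
| ext_refl s : ext_rel s s
| ext_sym s t : ext_rel s t -> ext_rel t s
| ext_trans s t u : ext_rel s t -> ext_rel t u -> ext_rel s u
| ext_cat s s' t t' :
    ext_rel s s' -> ext_rel t t' -> ext_rel (s ++ t) (s' ++ t')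
| ext_comm s t : ext_rel (s ++ t) (t ++ s)
| ext_scale a s t : ext_rel s t -> ext_rel (fscale a s) (fscale a t)
| ext_add a b (v : {ffun 'I_k -> V}) : ext_rel [:: (a, v); (b, v)] [:: (a + b, v)]
| ext_zero (v : {ffun 'I_k -> V}) : ext_rel [:: (0, v)] [::]
| ext_lin v i a x y :
    ext_rel [:: (1, upd v i (a *: x + y))]
            [:: (a, upd v i x); (1, upd v i y)]
| ext_alt (v : {ffun 'I_k -> V}) i j :
    i != j -> v i = v j -> ext_rel [:: (1, v)] [::].

Definition ext_relb (s t : formal) : bool := `[< ext_rel s t >].

Lemma ext_relb_refl : reflexive ext_relb.
Proof. by move=> s; apply/asboolP; apply: ext_refl. Qed.

Lemma ext_relb_sym : symmetric ext_relb.
Proof. by move=> s t; apply/asboolP/asboolP; apply: ext_sym. Qed.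

Lemma ext_relb_trans : transitive ext_relb.
Proof.
by move=> t s u /asboolP st /asboolP tu; apply/asboolP; apply: ext_trans tu.
Qed.

Canonical ext_equiv : equiv_rel formal :=
  EquivRel ext_relb ext_relb_refl ext_relb_sym ext_relb_trans.

Definition ext : Type := {eq_quot ext_equiv}.
HB.instance Definition _ := Choice.on ext.
HB.instance Definition _ := EqQuotient.on ext.

Lemma ext_eqP (s t : formal) : \pi_ext s = \pi_ext t <-> ext_rel s t.
Proof.
split=> [/eqquotP /asboolP //|st].
by apply/eqquotP/asboolP.
Qed.

Lemma ext_reprK (s : formal) : ext_rel (repr (\pi_ext s)) s.
Proof. by apply/ext_eqP; rewrite reprK. Qed.

Definition ext0 : ext := \pi_ext [::].
Definition extD (x y : ext) : ext := \pi_ext (repr x ++ repr y).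
Definition extZ (a : K) (x : ext) : ext := \pi_ext (fscale a (repr x)).
Definition extN (x : ext) : ext := extZ (-1) x.

Lemma extDE s t : extD (\pi_ext s) (\pi_ext t) = \pi_ext (s ++ t).
Proof. by apply/ext_eqP; apply: ext_cat; apply: ext_reprK. Qed.

Lemma extZE a s : extZ a (\pi_ext s) = \pi_ext (fscale a s).
Proof. by apply/ext_eqP; apply: ext_scale; apply: ext_reprK. Qed.

Lemma fscale_catl a b s : ext_rel (fscale a s ++ fscale b s) (fscale (a + b) s).
Proof.
elim: s => [|[c v] s IHs]; first exact: ext_refl.
have -> : fscale a ((c, v) :: s) ++ fscale b ((c, v) :: s)
    = [:: (a * c, v)] ++ ((fscale a s ++ [:: (b * c, v)]) ++ fscale b s).
  by rewrite /= -catA.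
apply: (ext_trans (t := [:: (a * c, v)]
    ++ (([:: (b * c, v)] ++ fscale a s) ++ fscale b s))).
  apply: ext_cat; first exact: ext_refl.
  by apply: ext_cat; [apply: ext_comm | apply: ext_refl].
have -> : [:: (a * c, v)] ++ (([:: (b * c, v)] ++ fscale a s) ++ fscale b s)
    = [:: (a * c, v); (b * c, v)] ++ (fscale a s ++ fscale b s) by [].
apply: (ext_cat (s' := [:: ((a + b) * c, v)])) IHs.
by rewrite mulrDl; apply: ext_add.
Qed.

Lemma fscale0 s : ext_rel (fscale 0 s) [::].
Proof.
elim: s => [|[c v] s IHs]; first exact: ext_refl.
apply: (ext_cat (s := [:: (0 * c, v)]) (s' := [::])) IHs.
by rewrite mul0r; apply: ext_zero.
Qed.

Lemma fscale1 s : fscale 1 s = s.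
Proof. by elim: s => [|[c v] s IHs] //=; rewrite mul1r IHs. Qed.

Lemma fscaleA a b s : fscale a (fscale b s) = fscale (a * b) s.
Proof. by elim: s => [|[c v] s IHs] //=; rewrite mulrA IHs. Qed.

Lemma extDA : associative extD.
Proof.
move=> x y z; rewrite -[x]reprK -[y]reprK -[z]reprK.
move: (repr x) (repr y) (repr z) => s t u.
by rewrite (extDE t u) (extDE s t) (extDE s (t ++ u)) (extDE (s ++ t) u) catA.
Qed.

Lemma extDC : commutative extD.
Proof. by move=> x y; apply/ext_eqP; apply: ext_comm. Qed.

Lemma ext0D : left_id ext0 extD.
Proof. by move=> x; rewrite -[x]reprK; move: (repr x) => s; rewrite extDE. Qed.

Lemma extND : left_inverse ext0 extN extD.
Proof.
move=> x; rewrite -[x]reprK; move: (repr x) => s.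
rewrite /extN extZE extDE; apply/ext_eqP.
rewrite -[X in _ ++ X]fscale1; apply: (ext_trans (fscale_catl _ _ _)).
by rewrite addNr; apply: fscale0.
Qed.

HB.instance Definition _ := GRing.isZmodule.Build ext extDA extDC ext0D extND.

Lemma extZA a b (x : ext) : extZ a (extZ b x) = extZ (a * b) x.
Proof. rewrite -[x]reprK; move: (repr x) => s.
by rewrite (extZE b s) (extZE a (fscale b s)) (extZE (a * b) s) fscaleA. Qed.

Lemma ext1Z : left_id 1 extZ.
Proof. by move=> x; rewrite -[x]reprK; move: (repr x) => s; rewrite extZE fscale1. Qed.

Lemma extZDr : right_distributive extZ +%R.
Proof.
move=> a x y; rewrite -[x]reprK -[y]reprK; move: (repr x) (repr y) => s t.
rewrite (extZE a s) (extZE a t) [X in extZ _ X]extDE.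
by rewrite (extZE a (s ++ t)) [RHS]extDE /fscale map_cat.
Qed.

Lemma extZDl (x : ext) : {morph extZ^~ x : a b / a + b}.
Proof.
move=> a b; rewrite -[x]reprK; move: (repr x) => s; rewrite (extZE (a + b) s).
rewrite (extZE a s) (extZE b s) [RHS]extDE; apply/ext_eqP.
by apply: ext_sym; apply: fscale_catl.
Qed.

HB.instance Definition _ :=
  GRing.Zmodule_isLmodule.Build K ext extZA ext1Z extZDr extZDl.

Definition wedge (v : {ffun 'I_k -> V}) : ext := \pi_ext [:: (1, v)].

Lemma ext_formalE (s : formal) : \pi_ext s = \sum_(p <- s) p.1 *: wedge p.2.
Proof.
elim: s => [|[a v] s IHs]; first by rewrite big_nil.
rewrite big_cons -IHs.
have -> : a *: wedge v = \pi_ext [:: (a, v)] :> ext.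
  by rewrite [LHS]extZE /fscale /= mulr1.
by rewrite [RHS]extDE.
Qed.

Lemma wedge_multilinear : multilinear_map wedge.
Proof.
move=> v i a x y; rewrite (_ : a *: _ = \pi_ext [:: (a, upd v i x)]).
  by rewrite [RHS]extDE; apply/ext_eqP; apply: ext_lin.
by rewrite [LHS]extZE /fscale /= mulr1.
Qed.

Lemma wedge_alternating : alternating_map wedge.
Proof. by move=> v i j nij vij; apply/ext_eqP; apply: ext_alt vij. Qed.

(* The linear map on the exterior power induced by g. It is meaningful only
   for multilinear alternating g: see ext_lift_linear and ext_lift_wedge. *)
Definition ext_lift (W : lmodType K) (g : {ffun 'I_k -> V} -> W) (x : ext) : W :=
  \sum_(p <- repr x) p.1 *: g p.2.

Section Universal.
Variables (W : lmodType K) (g : {ffun 'I_k -> V} -> W).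
Hypotheses (gM : multilinear_map g) (gA : alternating_map g).

Let ev (s : formal) : W := \sum_(p <- s) p.1 *: g p.2.

Let ev_fscale a s : ev (fscale a s) = a *: ev s.
Proof.
rewrite /ev /fscale big_map scaler_sumr; apply: eq_bigr => p _.
by rewrite scalerA.
Qed.

Let ev_rel s t : ext_rel s t -> ev s = ev t.
Proof.
elim=> {s t} //.
- by move=> s t u _ -> _ ->.
- move=> s s' t t' _ IHs _ IHt; rewrite /ev !big_cat /=.
  by congr (_ + _); [apply: IHs | apply: IHt].
- by move=> s t; rewrite /ev !big_cat /= addrC.
- by move=> a s t _ IHs; rewrite !ev_fscale IHs.
- by move=> a b v; rewrite /ev !big_cons !big_nil !addr0 scalerDl.
- by move=> v; rewrite /ev !big_cons !big_nil addr0 scale0r.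
- by move=> v i a x y; rewrite /ev !big_cons !big_nil !addr0 !scale1r gM.
- move=> v i j nij vij.
  by rewrite /ev big_cons !big_nil addr0 (gA nij vij) scaler0.
Qed.

Lemma ext_lift_wedge (v : {ffun 'I_k -> V}) : ext_lift g (wedge v) = g v.
Proof.
by rewrite [LHS](ev_rel (ext_reprK _)) /ev big_seq1 scale1r.
Qed.

Lemma ext_lift_linear (a : K) (x y : ext) :
  ext_lift g (a *: x + y) = a *: ext_lift g x + ext_lift g y.
Proof.
have -> : a *: x + y = \pi_ext (fscale a (repr x) ++ repr y).
  by rewrite -[y in LHS]reprK [LHS]extDE.
rewrite [LHS](ev_rel (ext_reprK _)) {1}/ev big_cat /=.
by rewrite -[X in X + _ = _]/(ev _) ev_fscale.
Qed.

End Universal.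
End ExteriorPower.

HB.mixin Record Lmodule_isNLie (K : fieldType) (n : nat) N
    of GRing.Lmodule K N := {
  nbr : {ffun 'I_n -> N} -> N;
  nbr_multilinear : multilinear_map nbr;
  nbr_skew : skew_symmetric_map nbr;
  nambu : forall (x : {ffun 'I_n.-1 -> N}) (y : {ffun 'I_n -> N}),
    nbr (snoc x (nbr y)) = \sum_(i < n) nbr (upd y i (nbr (snoc x (y i))))
}.

#[short(type="nLieType")]
HB.structure Definition NLie (K : fieldType) (n : nat) :=
  {N of Lmodule_isNLie K n N & GRing.Lmodule K N}.

Definition nlie_morphism (K : fieldType) (n : nat) (N N' : nLieType K n)
    (phi : {linear N -> N'}) : Prop :=
  forall x : {ffun 'I_n -> N}, phi (nbr x) = nbr (map_ffun phi x).

Section Cochains.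
Variables (K : fieldType) (n : nat).

Definition LL (N : nLieType K n) : lmodType K := ext N n.-1.

Definition ad (N : nLieType K n) (x : LL N) (z : N) : N :=
  ext_lift (fun v => nbr (snoc v z)) x.

Definition LLbr (N : nLieType K n) (x y : LL N) : LL N :=
  ext_lift (fun v => \sum_(i < n.-1) wedge (upd v i (ad x (v i)))) y.

Section Coboundary.
Variables (N N' : nLieType K n) (phi : N -> N').

Definition Lact (x : LL N) (w : N') : N' :=
  ext_lift (fun v => nbr (snoc (map_ffun phi v) w)) x.

Definition phibar (x : LL N) : LL N' :=
  ext_lift (fun v => wedge (map_ffun phi v)) x.

(* Maps of m arguments in LL N and one in N; C^m(N, N') is its subspace
   is_cochain. *)
Definition prechain (m : nat) : lmodType K := {ffun 'I_m -> LL N} -> N -> N'.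

(* Linear maps on the tensor product are the maps linear in each argument. The
   last clause is skew-symmetry in (x_m^1, ..., x_m^{n-1}, z), where
   x_m = v_1 /\ ... /\ v_{n-1}; it is void for m = 0. *)
Record is_cochain (m : nat) (f : prechain m) : Prop := IsCochain {
  cochain_multilinear : forall z : N, multilinear_map (f^~ z);
  cochain_linear : forall (x : {ffun 'I_m -> LL N}) (a : K) (z t : N),
    f x (a *: z + t) = a *: f x z + f x t;
  cochain_skew : forall (x : {ffun 'I_m -> LL N}) (j : 'I_m), j.+1 = m ->
    forall (s : 'S_n) (v v' : {ffun 'I_n.-1 -> N}) (z z' : N),
      snoc v' z' = [ffun i => snoc v z (s i)] ->
      f (upd x j (wedge v')) z' = (-1) ^+ s *: f (upd x j (wedge v)) z
}.

(* The operator delta^{m+1}. Indices start at 0 here, so that the entry i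
   below is the (i+1)-th one. *)
Definition delta (m : nat) (f : prechain m) : prechain m.+1 := fun x z =>
    \sum_(j < m.+1) \sum_(i < m.+1 | (i < j)%N)
      (-1) ^+ i.+1 *: f (del i (upd x j (LLbr (x i) (x j)))) z
  + \sum_(i < m.+1) (-1) ^+ i.+1 *: f (del i x) (ad (x i) z)
  + \sum_(i < m.+1) (-1) ^+ i.+2 *: Lact (x i) (f (del i x) z)
  + (-1) ^+ m *:
      ext_lift (fun v => \sum_(i < n.-1)
          nbr (snoc (upd (map_ffun phi v) i (f (del ord_max x) (v i))) (phi z)))
        (x ord_max).

(* C^{m-1}(N, N'), with C^{-1} = 0. *)
Definition prechain_pred (m : nat) : lmodType K :=
  if m is m'.+1 then prechain m' else 'rV[K]_0.

Definition is_cochain_pred (m : nat) : prechain_pred m -> Prop :=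
  match m with
  | 0 => fun=> True
  | m'.+1 => fun f : prechain m' => is_cochain f
  end.

Definition delta_pred (m : nat) : prechain_pred m -> prechain m :=
  match m with
  | 0 => fun=> 0
  | m'.+1 => fun f : prechain m' => delta f
  end.

End Coboundary.

Variables (N N' : nLieType K n) (phi : N -> N').

Definition morph_prechain (m : nat) : lmodType K :=
  (prechain N N m * prechain N' N' m * prechain_pred N N' m)%type.

Definition is_morph_cochain (m : nat) (c : morph_prechain m) : Prop :=
  [/\ is_cochain c.1.1, is_cochain c.1.2 & is_cochain_pred c.2].

Definition morph_delta (m : nat) (c : morph_prechain m) : morph_prechain m.+1 :=
  (delta idfun c.1.1,
   delta idfun c.1.2,
   delta_pred phi c.2
   + (-1) ^+ m *: ((fun x z => phi (c.1.1 x z)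
        - c.1.2 (map_ffun (phibar phi) x) (phi z)) : prechain N N' m)).

End Cochains.

(* The subspaces C m of the spaces V m form a cochain complex for d. *)
Record cochain_complex (K : fieldType) (V : nat -> lmodType K)
    (C : forall m, V m -> Prop) (d : forall m, V m -> V m.+1) : Prop :=
    CochainComplex {
  complex_zero : forall m, C m 0;
  complex_subspace : forall m (a : K) (x y : V m),
    C m x -> C m y -> C m (a *: x + y);
  complex_stable : forall m (x : V m), C m x -> C m.+1 (d m x);
  complex_linear : forall m (a : K) (x y : V m), C m x -> C m y ->
    d m (a *: x + y) = a *: d m x + d m y;
  complex_dd : forall m (x : V m), C m x -> d m.+1 (d m x) = 0
}.

(* Main.v *)
Require Import Defs.
From HB Require Import structures.
From mathcomp Require Import all_boot perm all_algebra.
From mathcomp Require Import boolp functions.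

(** The (n-1)-st exterior power L of an n-Lie algebra N is a Leibniz algebra for
    the bracket LLbr ([LLbr_leibniz]), because the bracket with x is the
    derivation of the exterior power that extends ad x, and by the Nambu
    identity ad is compatible with brackets ([ad_LLbr]).

    Let phi be a morphism from N to N'. The linear maps from N to N' form a
    bimodule over L ([hom_bimodule]). The left action of x is the commutator
    with the operators of x on N and N'. The right action of y sends g to
    g o ad y - ad (phibar y) o g - ad (D_g y) o phi, where D_g is the derivative
    of phibar in the direction g. This bimodule is not symmetric: the sum of the
    two actions of x on g is - ad (D_g x) o phi, and the axioms follow from the
    vanishing of the right action on such maps ([hom_r_der]) and from the rule
    for D_g and brackets ([ext_der_hom]).

    An m-cochain of N with values in N' is an m-linear map on L with values in
    this bimodule, and delta is the coboundary operator of Leibniz cohomology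
    ([delta_leib]). The latter squares to zero by Cartan calculus: with i_x the
    evaluation of the first argument at x and L_x the Lie derivative, it is
    determined by i_x d = L_x - d i_x, and [L_x, L_y] = L_[x,y], [L_x, d] = 0 and
    d d = 0 follow in turn by induction on the degree ([lie_der_br],
    [lie_der_leib_d], [leib_dd]). The degree 0 cases are the bimodule axioms.

    That delta f is again skew-symmetric in the last n vectors is a separate
    point ([leib_d_skew]): the Lie derivative acts on these vectors as a
    derivation, which commutes with their permutations.

    For the complex of phi, composition of cochains of N with phi and
    composition of cochains of N' with phi and phibar both commute with delta,
    by naturality of the Leibniz coboundary ([leib_d_natural]). So the operator
    of the direct sum is that of a mapping cone, and its square vanishes
    ([morph_delta_delta]). *)

Set Implicit Arguments.
Unset Strict Implicit.
Unset Printing Implicit Defensive.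

Import GRing.Theory.
Local Open Scope ring_scope.

(** * Linear maps and finite families *)

Lemma comb_sub (K : pzRingType) (V : lmodType K) a (x y x' y' : V) :
  a *: x + y - (a *: x' + y') = a *: (x - x') + (y - y').
Proof. by rewrite scalerBr opprD addrACA. Qed.

Section LinearMaps.
Variables (K : pzRingType) (V W : lmodType K) (f : V -> W).
Hypothesis fL : linear f.

Lemma linear_add x y : f (x + y) = f x + f y.
Proof. by have := fL 1 x y; rewrite !scale1r. Qed.

Lemma linear_zero : f 0 = 0.
Proof. by apply: (addrI (f 0)); rewrite -linear_add !addr0. Qed.

Lemma linear_scale a x : f (a *: x) = a *: f x.
Proof. by have := fL a x 0; rewrite linear_zero !addr0. Qed.

Lemma linear_opp x : f (- x) = - f x.
Proof. by rewrite -scaleN1r linear_scale scaleN1r. Qed.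

Lemma linear_sub x y : f (x - y) = f x - f y.
Proof. by rewrite linear_add linear_opp. Qed.

Lemma linear_big I (s : seq I) (P : pred I) (F : I -> V) :
  f (\sum_(i <- s | P i) F i) = \sum_(i <- s | P i) f (F i).
Proof. exact: (big_morph f linear_add linear_zero). Qed.

End LinearMaps.

Section Families.
Variable T : Type.

Lemma upd_same k (v : {ffun 'I_k -> T}) i x : upd v i x i = x.
Proof. by rewrite ffunE eqxx. Qed.

Lemma upd_other k (v : {ffun 'I_k -> T}) i j x : j != i -> upd v i x j = v j.
Proof. by rewrite ffunE => /negPf ->. Qed.

Lemma upd_id k (v : {ffun 'I_k -> T}) i : upd v i (v i) = v.
Proof. by apply/ffunP=> j; rewrite ffunE; case: eqP => // ->. Qed.

Lemma upd_upd k (v : {ffun 'I_k -> T}) i x y : upd (upd v i x) i y = upd v i y.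
Proof. by apply/ffunP=> j; rewrite !ffunE; case: eqP. Qed.

Lemma upd_comm k (v : {ffun 'I_k -> T}) i j x y : i != j ->
  upd (upd v i x) j y = upd (upd v j y) i x.
Proof.
move=> nij; apply/ffunP=> h; rewrite !ffunE.
by case: eqP => // ->; rewrite eq_sym (negPf nij).
Qed.

Lemma map_idfun k (v : {ffun 'I_k -> T}) : map_ffun idfun v = v.
Proof. by apply/ffunP=> j; rewrite ffunE. Qed.

Definition fcons m (x : T) (y : {ffun 'I_m -> T}) : {ffun 'I_m.+1 -> T} :=
  [ffun i => if unlift ord0 i is Some j then y j else x].

Lemma fcons_head m x (y : {ffun 'I_m -> T}) : fcons x y ord0 = x.
Proof. by rewrite ffunE unlift_none. Qed.

Lemma fcons_tail m x (y : {ffun 'I_m -> T}) j : fcons x y (lift ord0 j) = y j.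
Proof. by rewrite ffunE liftK. Qed.

Lemma fconsP m (P : {ffun 'I_m.+1 -> T} -> Prop) :
  (forall x y, P (fcons x y)) -> forall z, P z.
Proof.
move=> Pc z; rewrite (_ : z = fcons (z ord0) (del ord0 z)) //.
by apply/ffunP=> i; case: (unliftP ord0 i) => [j|] ->;
  rewrite ?fcons_tail ?fcons_head // ffunE.
Qed.

Lemma del_head m x (y : {ffun 'I_m -> T}) : del ord0 (fcons x y) = y.
Proof. by apply/ffunP=> j; rewrite ffunE fcons_tail. Qed.

Lemma del_tail m x (y : {ffun 'I_m.+1 -> T}) i :
  del (lift ord0 i) (fcons x y) = fcons x (del i y).
Proof.
apply/ffunP=> j; rewrite ffunE; case: (unliftP ord0 j) => [h|] ->.
  rewrite [RHS]fcons_tail [RHS]ffunE -[RHS](fcons_tail x y); congr (fcons x y _).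
  by apply: ord_inj; rewrite /= /bump /= !add1n ltnS addnS.
rewrite [RHS]fcons_head -[RHS](fcons_head x y); congr (fcons x y _); exact: ord_inj.
Qed.

Lemma upd_head m x (y : {ffun 'I_m -> T}) a : upd (fcons x y) ord0 a = fcons a y.
Proof.
apply/ffunP=> j; case: (unliftP ord0 j) => [h|] ->.
  by rewrite upd_other // !fcons_tail.
by rewrite upd_same fcons_head.
Qed.

Lemma upd_tail m x (y : {ffun 'I_m -> T}) i a :
  upd (fcons x y) (lift ord0 i) a = fcons x (upd y i a).
Proof.
apply/ffunP=> j; rewrite ffunE; case: (unliftP ord0 j) => [h|] ->.
  by rewrite !fcons_tail ffunE (inj_eq lift_inj).
by rewrite !fcons_head.
Qed.

Definition widenS n (i : 'I_n) : 'I_n.+1 := widen_ord (leqnSn n) i.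

Lemma widenS_max n (i : 'I_n) : widenS i != ord_max.
Proof. by rewrite -val_eqE /= neq_ltn ltn_ord. Qed.

Lemma snoc_widen n (v : {ffun 'I_n -> T}) z (i : 'I_n) :
  snoc (n := n.+1) v z (widenS i) = v i.
Proof.
rewrite ffunE; case: insubP => [j _ ji|]; last by rewrite /= ltn_ord.
by congr (v _); apply: val_inj.
Qed.

Lemma snoc_max n (v : {ffun 'I_n -> T}) z : snoc (n := n.+1) v z ord_max = z.
Proof. by rewrite ffunE insubN //= ltnn. Qed.

Lemma ord_maxP n (P : 'I_n.+1 -> Prop) :
  (forall i, P (widenS i)) -> P ord_max -> forall i, P i.
Proof.
move=> Pw Pm i; have [lt_in|] := ltnP i n.
  by rewrite (_ : i = widenS (Ordinal lt_in)) //; apply: val_inj.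
move=> le_ni; rewrite (_ : i = ord_max) //; apply: val_inj => /=.
by apply/eqP; rewrite eqn_leq le_ni -ltnS ltn_ord.
Qed.

Lemma snocP n (P : {ffun 'I_n.+1 -> T} -> Prop) :
  (forall v z, P (snoc (n := n.+1) v z)) -> forall w, P w.
Proof.
move=> Ps w.
rewrite (_ : w = snoc (n := n.+1) [ffun i => w (widenS i)] (w ord_max)) //.
apply/ffunP; apply: ord_maxP => [i|]; last by rewrite snoc_max.
by rewrite snoc_widen ffunE.
Qed.

Lemma upd_widen n (v : {ffun 'I_n -> T}) z i x :
  upd (snoc (n := n.+1) v z) (widenS i) x = snoc (n := n.+1) (upd v i x) z.
Proof.
apply/ffunP; apply: ord_maxP => [j|].
  by rewrite snoc_widen !ffunE -(snoc_widen v z j) !ffunE -!val_eqE.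
by rewrite upd_other ?snoc_max // eq_sym widenS_max.
Qed.

Lemma upd_max n (v : {ffun 'I_n -> T}) z x :
  upd (snoc (n := n.+1) v z) ord_max x = snoc (n := n.+1) v x.
Proof.
apply/ffunP; apply: ord_maxP => [j|]; last by rewrite upd_same snoc_max.
by rewrite upd_other ?widenS_max // !snoc_widen.
Qed.

End Families.

Section MapFamilies.
Variables (T U : Type) (g : T -> U).

Lemma map_upd k (v : {ffun 'I_k -> T}) i x :
  map_ffun g (upd v i x) = upd (map_ffun g v) i (g x).
Proof. by apply/ffunP=> j; rewrite !ffunE; case: eqP. Qed.

Lemma map_fcons m x (y : {ffun 'I_m -> T}) :
  map_ffun g (fcons x y) = fcons (g x) (map_ffun g y).
Proof.
by apply/ffunP=> j; rewrite !ffunE; case: unliftP => // h _; rewrite ffunE.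
Qed.

Lemma map_snoc n (v : {ffun 'I_n -> T}) z :
  map_ffun g (snoc (n := n.+1) v z) = snoc (n := n.+1) (map_ffun g v) (g z).
Proof.
apply/ffunP; apply: ord_maxP => [j|]; rewrite ffunE ?snoc_max //.
by rewrite !snoc_widen ffunE.
Qed.

End MapFamilies.

(** * Polarizations of multilinear maps *)

Section Derivations.
Variables (K : pzRingType) (V W Z : lmodType K) (k : nat).
Implicit Types (G : {ffun 'I_k -> W} -> Z) (v : {ffun 'I_k -> V}).

(** The coefficient of t in G((phi + t g) v_1, ..., (phi + t g) v_k). With
    phi the identity it is the action of g as a derivation. All sums over the
    slots of a bracket or of a decomposable that occur in the coboundary
    operator are of this form. *)
Definition polar (phi g : V -> W) G v : Z :=
  \sum_(i < k) G (upd (map_ffun phi v) i (g (v i))).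

Lemma polar_multilinear (phi g : V -> W) G :
  linear phi -> linear g -> multilinear_map G -> multilinear_map (polar phi g G).
Proof.
move=> phiL gL GM v i a x y; rewrite /polar scaler_sumr -big_split /=.
apply: eq_bigr => j _; rewrite !map_upd.
have [->|nji] := eqVneq j i; first by rewrite !upd_upd !upd_same gL GM.
have nij : i != j by rewrite eq_sym.
by rewrite !upd_other // !(upd_comm _ _ _ nij) phiL GM.
Qed.

(** Expand 0 = G(..., a + b, ..., a + b, ...). *)
Lemma alternating_swap G u i j a b :
  multilinear_map G -> alternating_map G -> i != j ->
  G (upd (upd u i a) j b) = - G (upd (upd u i b) j a).
Proof.
move=> GM GA nij; have nji : j != i by rewrite eq_sym.
have GD w h x y : G (upd w h (x + y)) = G (upd w h x) + G (upd w h y).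
  by have := GM w h 1 x y; rewrite !scale1r.
have G0 x : G (upd (upd u i x) j x) = 0.
  by apply: (GA _ i j nij); rewrite upd_same upd_other // upd_same.
have := G0 (a + b); rewrite GD ![upd (upd _ i (a + b)) _ _]upd_comm // !GD.
rewrite -![upd (upd _ j _) i _]upd_comm // !G0 add0r addr0 => /eqP.
by rewrite addrC addr_eq0 => /eqP.
Qed.

(** If v_i = v_j, the terms that modify a third slot vanish, and the two
    terms that modify the slots i and j are exchanged by a transposition. *)
Lemma polar_alternating (phi g : V -> W) G :
  multilinear_map G -> alternating_map G -> alternating_map (polar phi g G).
Proof.
move=> GM GA v i j nij vij; have nji : j != i by rewrite eq_sym.
rewrite /polar (bigD1 i) //= (bigD1 j) //= addrA big1 ?addr0 => [|h].
  have -> : upd (map_ffun phi v) i (g (v i))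
      = upd (upd (map_ffun phi v) i (g (v i))) j (phi (v i)).
    by rewrite vij -[phi (v j)](ffunE (fun x => phi (v x))) upd_comm // upd_id.
  rewrite alternating_swap // -vij.
  by rewrite -[phi (v i)](ffunE (fun x => phi (v x))) upd_id addNr.
case/andP=> nhi nhj; apply: (GA _ i j nij).
by rewrite !upd_other 1?eq_sym // !ffunE vij.
Qed.

Lemma polar_skew (phi g : V -> W) G :
  skew_symmetric_map G -> skew_symmetric_map (polar phi g G).
Proof.
move=> GS s v; rewrite /polar scaler_sumr [RHS](reindex_inj (perm_inj (s := s))).
apply: eq_bigr => i _; rewrite -GS ffunE; congr (G _).
by apply/ffunP=> j; rewrite !ffunE (inj_eq perm_inj).
Qed.

Lemma polar_linear_fun (phi g h : V -> W) G v a : multilinear_map G ->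
  polar phi (fun x => a *: g x + h x) G v = a *: polar phi g G v + polar phi h G v.
Proof.
by move=> GM; rewrite /polar scaler_sumr -big_split; apply: eq_bigr => i _; apply: GM.
Qed.

End Derivations.

(** Both sides collect the terms in which g and X' act on slots i and j. For
    i != j the two updates commute and phi X = X' phi turns X' into X. For i = j
    the left side has X' g, which is split as g X + (X' g - g X). *)
Lemma polar_comm (K : pzRingType) (V W Z : lmodType K) (k : nat)
    (phi g : V -> W) (X : V -> V) (X' : W -> W)
    (G : {ffun 'I_k -> W} -> Z) (v : {ffun 'I_k -> V}) :
  multilinear_map G -> (forall x, phi (X x) = X' (phi x)) ->
  \sum_(i < k) polar idfun X' G (upd (map_ffun phi v) i (g (v i)))
  = polar idfun X (polar phi g G) v + polar phi (fun x => X' (g x) - g (X x)) G v.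
Proof.
move=> GM phiX; rewrite /polar [X in _ = X + _]exchange_big /= -big_split /=.
apply: eq_bigr => i _.
rewrite (bigD1 i) //= [in RHS](bigD1 i) //= map_idfun upd_upd upd_same.
rewrite map_upd upd_upd upd_same addrAC -{1}[X' _](subrK (g (X (v i)))).
have GD w h x y : G (upd w h (x + y)) = G (upd w h x) + G (upd w h y).
  by have := GM w h 1 x y; rewrite !scale1r.
rewrite GD !map_idfun [X in X + _ = _]addrC; congr (_ + _).
apply: eq_bigr => j nji.
rewrite map_upd !upd_other // 1?eq_sym // ffunE -phiX.
by rewrite upd_comm // eq_sym.
Qed.

(** * Functoriality and derivations of exterior powers *)

Section ExtLift.
Variables (K : fieldType) (V : lmodType K) (k : nat).

(** The decomposables span the exterior power. Identities below are checked
    on them by this lemma. *)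
Lemma ext_linear_eq (W : lmodType K) (F G : ext V k -> W) :
  linear F -> linear G -> (forall v, F (wedge v) = G (wedge v)) -> F =1 G.
Proof.
move=> FL GL FG x; rewrite -[x]reprK ext_formalE (linear_big FL) (linear_big GL).
by apply: eq_bigr => p _; rewrite (linear_scale FL) (linear_scale GL) FG.
Qed.

Lemma ext_lift_linear_fun (W Z : lmodType K) (F : W -> Z) (g : {ffun 'I_k -> V} -> W) x :
  linear F -> F (ext_lift g x) = ext_lift (fun v => F (g v)) x.
Proof.
move=> FL; rewrite /ext_lift (linear_big FL); apply: eq_bigr => p _.
by rewrite linear_scale.
Qed.

Lemma eq_ext_lift (W : lmodType K) (g h : {ffun 'I_k -> V} -> W) :
  g =1 h -> ext_lift g =1 ext_lift h.
Proof. by move=> gh x; apply: eq_bigr => p _; rewrite gh. Qed.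

Lemma ext_lift_comb (W : lmodType K) a (g h : {ffun 'I_k -> V} -> W) x :
  ext_lift (fun v => a *: g v + h v) x = a *: ext_lift g x + ext_lift h x.
Proof.
rewrite /ext_lift scaler_sumr -big_split; apply: eq_bigr => p _ /=.
by rewrite scalerDr !scalerA mulrC.
Qed.

End ExtLift.

Section ExtDer.
Variables (K : fieldType) (V W : lmodType K) (k : nat).
Implicit Types (phi g : V -> W) (x : ext V k).

Definition ext_map phi x : ext W k := ext_lift (fun v => wedge (map_ffun phi v)) x.

(** The derivative of ext_map at phi in the direction g. For phi the identity
    it is the derivation of the exterior power that extends g. *)
Definition ext_der phi g x : ext W k := ext_lift (polar phi g (@wedge K W k)) x.

Lemma ext_map_multilinear phi :
  linear phi -> multilinear_map (fun v => @wedge K W k (map_ffun phi v)).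
Proof. by move=> phiL v i a x y; rewrite !map_upd phiL wedge_multilinear. Qed.

Lemma ext_map_alternating phi : alternating_map (fun v => @wedge K W k (map_ffun phi v)).
Proof.
by move=> v i j nij vij; apply: (wedge_alternating nij); rewrite !ffunE vij.
Qed.

Lemma ext_map_linear phi : linear phi -> linear (ext_map phi).
Proof.
move=> phiL a x y.
exact: (ext_lift_linear (ext_map_multilinear phiL) (@ext_map_alternating phi)).
Qed.

Lemma ext_map_wedge phi v : linear phi ->
  ext_map phi (wedge v) = wedge (map_ffun phi v).
Proof.
move=> phiL.
exact: (ext_lift_wedge (ext_map_multilinear phiL) (@ext_map_alternating phi)).
Qed.

Lemma ext_der_linear phi g : linear phi -> linear g -> linear (ext_der phi g).
Proof.
move=> phiL gL a x y; apply: ext_lift_linear.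
  exact: (polar_multilinear phiL gL (@wedge_multilinear _ _ _)).
exact: (polar_alternating _ _ (@wedge_multilinear _ _ _) (@wedge_alternating _ _ _)).
Qed.

Lemma ext_der_wedge phi g v : linear phi -> linear g ->
  ext_der phi g (wedge v) = polar phi g (@wedge K W k) v.
Proof.
move=> phiL gL; apply: ext_lift_wedge.
  exact: (polar_multilinear phiL gL (@wedge_multilinear _ _ _)).
exact: (polar_alternating _ _ (@wedge_multilinear _ _ _) (@wedge_alternating _ _ _)).
Qed.

Lemma ext_der_comb phi g h a x :
  ext_der phi (fun z => a *: g z + h z) x = a *: ext_der phi g x + ext_der phi h x.
Proof.
rewrite -ext_lift_comb; apply: eq_ext_lift => v.
by rewrite polar_linear_fun //; apply: wedge_multilinear.
Qed.

End ExtDer.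

Section ExtDerComm.
Variables (K : fieldType) (V W : lmodType K) (k : nat).
Variables (phi : V -> W) (X : V -> V) (X' : W -> W).
Hypotheses (phiL : linear phi) (XL : linear X) (X'L : linear X').

Let idL (U : lmodType K) : linear (@idfun U). Proof. by []. Qed.

Lemma ext_der_map (x : ext V k) :
  ext_der idfun X' (ext_map phi x) = ext_der phi (fun z => X' (phi z)) x.
Proof.
have X'phiL : linear (fun z => X' (phi z)) by move=> a u v; rewrite phiL X'L.
move: x; apply: ext_linear_eq => [a u v|a u v|v].
- by rewrite (ext_map_linear phiL) ext_der_linear.
- by rewrite ext_der_linear.
rewrite ext_map_wedge // !ext_der_wedge //; apply: eq_bigr => i _.
by rewrite map_idfun ffunE.
Qed.

Lemma ext_map_der (x : ext V k) :
  ext_map phi (ext_der idfun X x) = ext_der phi (fun z => phi (X z)) x.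
Proof.
have phiXL : linear (fun z => phi (X z)) by move=> a u v; rewrite XL phiL.
move: x; apply: ext_linear_eq => [a u v|a u v|v].
- by rewrite ext_der_linear // (ext_map_linear phiL).
- by rewrite ext_der_linear.
rewrite !ext_der_wedge // (linear_big (ext_map_linear phiL)).
by apply: eq_bigr => i _; rewrite ext_map_wedge // map_upd map_idfun.
Qed.

(** The derivative of the functoriality of ext_map. With phi the identity and
    X' = X it says that ext_der sends commutators to commutators. *)
Lemma ext_der_comm (g : V -> W) (x : ext V k) :
  linear g -> (forall z, phi (X z) = X' (phi z)) ->
  ext_der idfun X' (ext_der phi g x)
  = ext_der phi g (ext_der idfun X x) + ext_der phi (fun z => X' (g z) - g (X z)) x.
Proof.
move=> gL phiX.
have cL : linear (fun z => X' (g z) - g (X z)).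
  by move=> a u v; rewrite gL XL X'L gL opprD scalerBr addrACA.
have dL := ext_der_linear phiL gL; have dL' := ext_der_linear (@idL W) X'L.
have dX := ext_der_linear (@idL V) XL.
move: x; apply: ext_linear_eq => [a u v|a u v|v].
- by rewrite dL dL'.
- by rewrite dX dL (ext_der_linear phiL cL) scalerDr addrACA.
rewrite !ext_der_wedge // (linear_big (dL' k)) (linear_big (dL k)).
under eq_bigr do rewrite ext_der_wedge //.
rewrite (polar_comm _ _ (@wedge_multilinear _ _ _) phiX); congr (_ + _).
by apply: eq_bigr => i _; rewrite ext_der_wedge.
Qed.

End ExtDerComm.

(** * The Leibniz algebra attached to an n-Lie algebra *)

Section Bracket.
Variables (K : fieldType) (n : nat).
Hypothesis two_neq0 : 2%:R != 0 :> K.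

(** The transposition of two equal entries gives g v = - g v. *)
Lemma skew_alternating (V W : lmodType K) k (g : {ffun 'I_k -> V} -> W) :
  skew_symmetric_map g -> alternating_map g.
Proof.
move=> gS v i j nij vij; have := gS (tperm i j) v.
rewrite odd_tperm nij expr1 scaleN1r.
have -> : [ffun h => v (tperm i j h)] = v.
  by apply/ffunP=> h; rewrite ffunE; case: tpermP => // ->.
move/eqP; rewrite -addr_eq0 -mulr2n -scaler_nat scaler_eq0 (negPf two_neq0).
by move/eqP.
Qed.

Section Adjoint.
Variable N : nLieType K n.+1.
Implicit Types (x y : LL N) (z : N).

Lemma nbr_alternating : alternating_map (nbr : {ffun 'I_n.+1 -> N} -> N).
Proof. exact/skew_alternating/nbr_skew. Qed.

Lemma nbr_snoc_multilinear z :
  multilinear_map (fun v : {ffun 'I_n -> N} => nbr (snoc (n := n.+1) v z)).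
Proof. by move=> v i a u t; rewrite -!upd_widen nbr_multilinear. Qed.

Lemma nbr_snoc_alternating z :
  alternating_map (fun v : {ffun 'I_n -> N} => nbr (snoc (n := n.+1) v z)).
Proof.
move=> v i j nij vij; apply: (@nbr_alternating _ (widenS i) (widenS j)).
  by apply: contra nij => /eqP/(congr1 val) /= /eqP.
by rewrite !snoc_widen.
Qed.

Lemma ad_linear_l z : linear (fun x => ad x z).
Proof.
move=> a x y; apply: ext_lift_linear.
- exact: nbr_snoc_multilinear.
- exact: nbr_snoc_alternating.
Qed.

Lemma ad_wedge (v : {ffun 'I_n -> N}) z : ad (wedge v) z = nbr (snoc (n := n.+1) v z).
Proof.
apply: ext_lift_wedge.
- exact: nbr_snoc_multilinear.
- exact: nbr_snoc_alternating.
Qed.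

Lemma ad_linear x : linear (ad x).
Proof.
move=> a z t; rewrite /ad -ext_lift_comb; apply: eq_ext_lift => v.
by rewrite -(upd_max v z (a *: z + t)) nbr_multilinear !upd_max.
Qed.

(** On decomposables this is the Nambu identity. Both sides are linear in x. *)
Lemma ad_nbr x (w : {ffun 'I_n.+1 -> N}) : ad x (nbr w) = polar idfun (ad x) nbr w.
Proof.
move: x; apply: ext_linear_eq => [|a x y|v]; first exact: ad_linear_l.
  rewrite /polar scaler_sumr -big_split /=; apply: eq_bigr => i _.
  by rewrite ad_linear_l nbr_multilinear.
rewrite ad_wedge nambu; apply: eq_bigr => i _.
by rewrite map_idfun ad_wedge.
Qed.

(** The bracket with x is the derivation of the exterior power that extends
    ad x. So the Leibniz identity reduces to facts about ext_der. *)
Lemma LLbrE x y : LLbr x y = ext_der idfun (ad x) y.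
Proof. by apply: eq_ext_lift => v; rewrite /polar map_idfun. Qed.

Lemma LLbr_linear_l y : linear (fun x => LLbr x y).
Proof.
move=> a x x'; rewrite !LLbrE -ext_der_comb; congr (ext_der _ _ _).
by apply: funext => z; rewrite ad_linear_l.
Qed.

Lemma LLbr_linear x : linear (LLbr x).
Proof. by move=> a y y'; rewrite !LLbrE (ext_der_linear _ (ad_linear x)). Qed.

Lemma polar_nbr_snoc (N1 : lmodType K) (phi g : N1 -> N)
    (v : {ffun 'I_n -> N1}) (z : N1) :
  polar phi g nbr (snoc (n := n.+1) v z)
  = polar phi g (fun u => nbr (snoc (n := n.+1) u (phi z))) v
    + nbr (snoc (n := n.+1) (map_ffun phi v) (g z)).
Proof.
rewrite /polar big_ord_recr /= snoc_max map_snoc upd_max; congr (_ + _).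
by apply: eq_bigr => i _; rewrite -/(widenS i) snoc_widen upd_widen.
Qed.

(** The Nambu identity again: apply ad x to the bracket (v_1, ..., v_n, z),
    where y is the wedge of the v_i. The term in which ad x hits z is
    ad y (ad x z), and the other terms add up to ad (LLbr x y) z. *)
Lemma ad_LLbr x y z : ad (LLbr x y) z = ad x (ad y z) - ad y (ad x z).
Proof.
move: y; apply: ext_linear_eq => [a y y'|a y y'|v].
- by rewrite LLbr_linear ad_linear_l.
- by rewrite !(ad_linear_l, ad_linear) scalerBr opprD addrACA.
rewrite LLbrE ext_der_wedge //; last exact: ad_linear.
rewrite (linear_big (ad_linear_l z)) !ad_wedge ad_nbr polar_nbr_snoc map_idfun addrK.
by apply: eq_bigr => i _; rewrite map_idfun ad_wedge.
Qed.

(** By ext_der_comm the derivations ad x and ad y of the exterior power have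
    as commutator the derivation of [ad x, ad y], which is ad (LLbr x y). *)
Lemma LLbr_leibniz x y (z : LL N) :
  LLbr x (LLbr y z) = LLbr (LLbr x y) z + LLbr y (LLbr x z).
Proof.
rewrite !LLbrE.
rewrite (@ext_der_comm _ _ _ _ idfun (ad x) (ad x)) //; try exact: ad_linear.
rewrite addrC; congr (ext_der _ _ _ + _); apply: funext => t.
by rewrite -ad_LLbr LLbrE.
Qed.

End Adjoint.

Section Morphism.
Variables (N N' : nLieType K n.+1) (phi : {linear N -> N'}).
Hypothesis phiM : nlie_morphism phi.

Lemma phibar_linear : linear (phibar phi).
Proof. exact/ext_map_linear/linearP. Qed.

Lemma phi_ad x z : phi (ad x z) = ad (phibar phi x) (phi z).
Proof.
move: x; apply: ext_linear_eq => [a x y|a x y|v].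
- by rewrite ad_linear_l linearP.
- by rewrite phibar_linear ad_linear_l.
by rewrite ad_wedge phiM map_snoc [phibar _ _]ext_map_wedge ?ad_wedge //; apply: linearP.
Qed.

Lemma phibar_LLbr x y : phibar phi (LLbr x y) = LLbr (phibar phi x) (phibar phi y).
Proof.
rewrite !LLbrE [LHS]ext_map_der; [|exact: linearP|exact: ad_linear].
rewrite [RHS]ext_der_map; [|exact: linearP|exact: ad_linear].
by congr (ext_der _ _ _); apply: funext => z; rewrite phi_ad.
Qed.

Lemma LactE x w : Lact phi x w = ad (phibar phi x) w.
Proof.
rewrite [RHS](ext_lift_linear_fun _ _ (ad_linear_l w)).
by apply: eq_ext_lift => v; rewrite ad_wedge.
Qed.

End Morphism.
End Bracket.

(** * Cohomology of Leibniz algebras *)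

Lemma commutator_regroup (V : zmodType) (a b c d e h : V) :
  a - b - (h - e) = a - c - (d - e) - (b - d - (c - h)).
Proof.
rewrite !opprB !addrA.
(* The permutation puts the terms that cancel next to each other. *)
by rewrite [RHS](ACl (1*8*3*6*(2*5)*(4*7))) /= !addNr !addr0.
Qed.

Lemma subr_regroup (V : zmodType) (a b p q : V) :
  a - p - (a - b - q) = b - (p - q).
Proof.
by rewrite !opprB !addrA [LHS](ACl (4*3*2*(1*5))) /= subrr addr0.
Qed.

Lemma middle_axiom_regroup (V : zmodType) (a b c d e h k q u v : V) : v + u = c - h ->
  a - b - c - (d - e - h) = a - k - (q - e) - u + (k - d - (b - q) - v).
Proof.
move/(canRL (addKr _)) ->.
rewrite !opprD !opprK !addrA.
rewrite [RHS](ACl (1*10*6*9*4*7*(2*8)*(3*11)*(5*12))) /=.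
by rewrite !addNr subrr !addr0.
Qed.

(** A left Leibniz algebra (L, br) and a bimodule over it. The actions are
    defined on H, but they satisfy the axioms, and are linear in L, only on the
    elements of a submodule P. The application has P the linear maps inside a
    space of arbitrary functions, so that cochains are plain functions. The
    last three axioms are the Leibniz identity x(yz) = (xy)z + y(xz) with the
    element of the bimodule as last, middle and first factor. *)
Record leibniz_bimodule (K : pzRingType) (L H : lmodType K) (br : L -> L -> L)
    (l : L -> H -> H) (r : H -> L -> H) (P : H -> Prop) : Prop := LeibnizBimodule {
  bimod_br_linear : forall x, linear (br x);
  bimod_br_linear_l : forall y, linear (br^~ y);
  bimod_jacobi : forall x y z, br x (br y z) = br (br x y) z + br y (br x z);
  bimod_l_linear : forall x, linear (l x);
  bimod_r_linear : forall y, linear (r^~ y);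
  bimod_P0 : P 0;
  bimod_P_comb : forall a g h, P g -> P h -> P (a *: g + h);
  bimod_P_l : forall x g, P g -> P (l x g);
  bimod_P_r : forall g y, P g -> P (r g y);
  bimod_l_linear_l : forall g, P g -> linear (l^~ g);
  bimod_r_linear_r : forall g, P g -> linear (r g);
  bimod_l_br : forall x y g, P g -> l (br x y) g = l x (l y g) - l y (l x g);
  bimod_r_br : forall x y g, P g -> l x (r g y) = r (l x g) y + r g (br x y);
  bimod_br_r : forall x y g, P g -> r g (br x y) = r (r g x) y + l x (r g y)
}.

Section LeibnizComplex.
Variables (K : pzRingType) (L H : lmodType K).
Variables (br : L -> L -> L) (l : L -> H -> H) (r : H -> L -> H).

(** The Lie derivative along x of an L-cochain with values in H. *)
Definition lie_der m (x : L) (f : {ffun 'I_m -> L} -> H) (y : {ffun 'I_m -> L}) : H :=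
  l x (f y) - polar idfun (br x) f y.

(** The coboundary operator, defined by Cartan's formula
    i_x d = L_x - d i_x, where i_x evaluates the first argument at x. This
    recursion makes all proofs about it inductions on the degree. In degree 0
    only the right action is left, and its sign is forced by d d = 0. *)
Fixpoint leib_d m : ({ffun 'I_m -> L} -> H) -> {ffun 'I_m.+1 -> L} -> H :=
  match m with
  | 0 => fun f x => - r (f (del ord0 x)) (x ord0)
  | m'.+1 => fun f x => lie_der (x ord0) f (del ord0 x)
      - leib_d (fun y => f (fcons (x ord0) y)) (del ord0 x)
  end.

Lemma leib_d0 (f : {ffun 'I_0 -> L} -> H) x y : leib_d f (fcons x y) = - r (f y) x.
Proof. by rewrite /= del_head fcons_head. Qed.

Lemma leib_dS m (f : {ffun 'I_m.+1 -> L} -> H) x y :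
  leib_d f (fcons x y) = lie_der x f y - leib_d (fun y' => f (fcons x y')) y.
Proof. by rewrite /= del_head fcons_head. Qed.

Lemma polar_cons (D : L -> L) m (f : {ffun 'I_m.+1 -> L} -> H) x y :
  polar idfun D f (fcons x y)
  = f (fcons (D x) y) + polar idfun D (fun y' => f (fcons x y')) y.
Proof.
rewrite /polar big_ord_recl !map_idfun upd_head fcons_head; congr (_ + _).
by apply: eq_bigr => i _; rewrite upd_tail fcons_tail.
Qed.

(** Cartan's formula i_y L_x = L_x i_y - i_[x,y]. *)
Lemma lie_der_cons m (f : {ffun 'I_m.+1 -> L} -> H) x y z :
  lie_der x f (fcons y z) = lie_der x (fun z' => f (fcons y z')) z - f (fcons (br x y) z).
Proof. by rewrite /lie_der polar_cons opprD [- _ - _]addrC addrA. Qed.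

Lemma polar0 (D : L -> L) (f : {ffun 'I_0 -> L} -> H) y : polar idfun D f y = 0.
Proof. by rewrite /polar big_ord0. Qed.

Lemma lie_der0 (f : {ffun 'I_0 -> L} -> H) x y : lie_der x f y = l x (f y).
Proof. by rewrite /lie_der polar0 subr0. Qed.

Variable P : H -> Prop.
Hypothesis bimH : leibniz_bimodule br l r P.

Let l_linear := bimod_l_linear bimH.
Let r_linear := bimod_r_linear bimH.

Lemma lie_der_comb m x a (f g : {ffun 'I_m -> L} -> H) y :
  lie_der x (fun y' => a *: f y' + g y') y = a *: lie_der x f y + lie_der x g y.
Proof.
rewrite /lie_der l_linear scalerBr addrACA -opprD; congr (_ - _).
by rewrite /polar scaler_sumr -big_split.
Qed.

Lemma leib_d_comb m a (f g : {ffun 'I_m -> L} -> H) x :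
  leib_d (fun y => a *: f y + g y) x = a *: leib_d f x + leib_d g x.
Proof.
elim: m => [|m IHm] in f g x *.
  by elim/fconsP: x => x y; rewrite !leib_d0 r_linear opprD scalerN.
elim/fconsP: x => x y; rewrite !leib_dS lie_der_comb IHm.
by rewrite scalerBr addrACA -opprD.
Qed.

Lemma leib_dB m (f g : {ffun 'I_m -> L} -> H) x :
  leib_d (fun y => f y - g y) x = leib_d f x - leib_d g x.
Proof.
rewrite (_ : (fun y => f y - g y) = (fun y => (-1) *: g y + f y)).
  by rewrite leib_d_comb scaleN1r addrC.
by apply: funext => y; rewrite scaleN1r addrC.
Qed.

Lemma lie_derB m x (f g : {ffun 'I_m -> L} -> H) y :
  lie_der x (fun y' => f y' - g y') y = lie_der x f y - lie_der x g y.
Proof.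
rewrite (_ : (fun y => f y - g y) = (fun y => (-1) *: g y + f y)).
  by rewrite lie_der_comb scaleN1r addrC.
by apply: funext => y'; rewrite scaleN1r addrC.
Qed.

Lemma multilinear_cons m (f : {ffun 'I_m.+1 -> L} -> H) x :
  multilinear_map f -> multilinear_map (fun y => f (fcons x y)).
Proof. by move=> fM y i a u v; rewrite -!upd_tail fM. Qed.

Lemma multilinear_head m (f : {ffun 'I_m.+1 -> L} -> H) y :
  multilinear_map f -> linear (fun x => f (fcons x y)).
Proof.
by move=> fM a u v; rewrite -(upd_head 0) fM !upd_head.
Qed.

Lemma multilinear_headP m (f : {ffun 'I_m.+1 -> L} -> H) :
  (forall y, linear (fun x => f (fcons x y))) ->
  (forall x, multilinear_map (fun y => f (fcons x y))) -> multilinear_map f.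
Proof.
move=> fh ft v i a x y; elim/fconsP: v => u v.
by case: (unliftP ord0 i) => [j|] ->; rewrite ?upd_head ?upd_tail ?fh ?ft.
Qed.

Let br_leibniz := bimod_jacobi bimH.
Let l_br := bimod_l_br bimH.
Let r_br := bimod_r_br bimH.
Let br_r := bimod_br_r bimH.

(** Evaluate the first argument at u and push u through the Lie derivatives
    by lie_der_cons. The terms in which u has been bracketed once cancel, those
    in which it has been bracketed twice cancel by the Leibniz identity, and the
    rest is the induction hypothesis. In degree 0 it is a bimodule axiom. *)
Lemma lie_der_br m (f : {ffun 'I_m -> L} -> H) x y z :
  multilinear_map f -> (forall u, P (f u)) ->
  lie_der (br x y) f z = lie_der x (lie_der y f) z - lie_der y (lie_der x f) z.
Proof.
elim: m => [|m IHm] in f z * => fM fP.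
  by rewrite !lie_der0 l_br.
elim/fconsP: z => u z; rewrite !lie_der_cons.
rewrite (IHm (fun z' => f (fcons u z'))) //; last exact: multilinear_cons.
pose F v := fun z' => f (fcons v z').
have E w : (fun z' => lie_der w f (fcons u z'))
   = (fun z' => lie_der w (F u) z' - F (br w u) z').
  by apply: funext => z'; rewrite lie_der_cons.
rewrite !E !lie_derB /F.
rewrite [br (br x y) u](_ : _ = br x (br y u) - br y (br x u)); last first.
  by rewrite br_leibniz addrK.
rewrite (linear_sub (multilinear_head z fM)).
exact: commutator_regroup.
Qed.

(** Evaluate the first argument: by Cartan's formulas the difference of the
    two sides becomes [L_x, L_y] - L_[x,y], which is 0, minus the difference for
    a cochain of lower degree. In degree 0 it is the middle bimodule axiom. *)
Lemma lie_der_leib_d m (f : {ffun 'I_m -> L} -> H) x y :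
  multilinear_map f -> (forall u, P (f u)) ->
  lie_der x (leib_d f) y = leib_d (lie_der x f) y.
Proof.
elim: m => [|m IHm] in f y * => fM fP; elim/fconsP: y => y z.
  rewrite lie_der_cons lie_der0 !leib_d0 lie_der0 (linear_opp (l_linear x)).
  by rewrite r_br // opprD opprK subrK.
pose F v := fun z' => f (fcons v z').
have FM v : multilinear_map (F v) by apply: multilinear_cons.
have FP v u : P (F v u) by apply: fP.
have E w v : (fun z' => lie_der w f (fcons v z'))
   = (fun z' => lie_der w (F v) z' - F (br w v) z').
  by apply: funext => z'; rewrite lie_der_cons.
have D v : (fun z' => leib_d f (fcons v z'))
   = (fun z' => lie_der v f z' - leib_d (F v) z').
  by apply: funext => z'; rewrite leib_dS.
rewrite lie_der_cons !leib_dS D E lie_derB leib_dB -IHm // lie_der_br //.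
exact: subr_regroup.
Qed.

(** i_x d d = L_x d - d i_x d = L_x d - d L_x + d d i_x, where the first two
    terms cancel and the last one is 0 by induction. In degree 0 this is the
    bimodule axiom with the coefficient as first factor. *)
Lemma leib_dd m (f : {ffun 'I_m -> L} -> H) x :
  multilinear_map f -> (forall u, P (f u)) -> leib_d (leib_d f) x = 0.
Proof.
elim: m => [|m IHm] in f x * => fM fP; elim/fconsP: x => x y.
  rewrite leib_dS; elim/fconsP: y => y z; rewrite lie_der_cons lie_der0 !leib_d0.
  rewrite (linear_opp (l_linear x)) (linear_opp (r_linear y)) !opprK br_r //.
  by rewrite addrCA addNr addr0 subrr.
pose F v := fun z' => f (fcons v z').
have FM v : multilinear_map (F v) by apply: multilinear_cons.
have FP v u : P (F v u) by apply: fP.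
have D v : (fun z' => leib_d f (fcons v z'))
   = (fun z' => lie_der v f z' - leib_d (F v) z').
  by apply: funext => z'; rewrite leib_dS.
by rewrite leib_dS D leib_dB IHm // subr0 lie_der_leib_d // subrr.
Qed.

Let br_linear := bimod_br_linear bimH.
Let br_linear_l := bimod_br_linear_l bimH.
Let l_linear_l := bimod_l_linear_l bimH.
Let r_linear_r := bimod_r_linear_r bimH.
Let P_zero := bimod_P0 bimH.
Let P_comb := bimod_P_comb bimH.
Let P_l := bimod_P_l bimH.
Let P_r := bimod_P_r bimH.

Lemma lie_der_multilinear m x (f : {ffun 'I_m -> L} -> H) :
  multilinear_map f -> multilinear_map (lie_der x f).
Proof.
move=> fM y i a u v; rewrite /lie_der fM l_linear.
rewrite (polar_multilinear _ (br_linear x) fM) //.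
by rewrite comb_sub.
Qed.

Lemma leib_d_multilinear m (f : {ffun 'I_m -> L} -> H) :
  multilinear_map f -> (forall u, P (f u)) -> multilinear_map (leib_d f).
Proof.
elim: m => [|m IHm] in f * => fM fP; apply: multilinear_headP.
- by move=> y a u v; rewrite !leib_d0 r_linear_r // opprD scalerN.
- by move=> x y [].
- move=> y a u v; rewrite !leib_dS.
  rewrite (_ : (fun y' => f (fcons (a *: u + v) y'))
    = (fun y' => a *: f (fcons u y') + f (fcons v y'))); last first.
    by apply: funext => y'; rewrite (multilinear_head y' fM).
  rewrite leib_d_comb scalerBr addrACA -opprD; congr (_ - _).
  rewrite /lie_der l_linear_l // scalerBr addrACA -opprD; congr (_ - _).
  have -> : br (a *: u + v) = (fun z => a *: br u z + br v z).
    by apply: funext => z; rewrite br_linear_l.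
  exact: polar_linear_fun.
move=> x y i a u v; rewrite !leib_dS lie_der_multilinear //.
rewrite (IHm (fun y' => f (fcons x y'))) //; last exact: multilinear_cons.
by rewrite comb_sub.
Qed.

Lemma leib_d_closed m (f : {ffun 'I_m -> L} -> H) x :
  (forall u, P (f u)) -> P (leib_d f x).
Proof.
have PN g : P g -> P (- g).
  by move=> Pg; have := P_comb (-1) Pg P_zero; rewrite scaleN1r addr0.
have PD g h : P g -> P h -> P (g + h).
  by move=> Pg Ph; have := P_comb 1 Pg Ph; rewrite scale1r.
elim: m f x => [|m IHm] f x fP; elim/fconsP: x => x y.
  by rewrite leib_d0; apply: PN; apply: P_r.
rewrite leib_dS; apply: (PD); last by apply: PN; apply: IHm.
apply: (PD); first exact: P_l.
apply: PN; apply: (@big_ind _ P); [exact: P_zero | exact: PD | by []].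
Qed.

End LeibnizComplex.

(** Cochains are contravariant in the Leibniz algebra (along psi) and
    covariant in the coefficients (along T). Both functorialities are needed,
    one for each of the two halves of the defect of a pair of cochains. *)
Lemma leib_d_natural (K : pzRingType) (L L' H H' : lmodType K)
    (br : L -> L -> L) (l : L -> H -> H) (r : H -> L -> H)
    (br' : L' -> L' -> L') (l' : L' -> H' -> H') (r' : H' -> L' -> H')
    (psi : L' -> L) (T : H -> H') (P : H -> Prop) :
  linear T ->
  (forall x y, psi (br' x y) = br (psi x) (psi y)) ->
  (forall x g, P g -> T (l (psi x) g) = l' x (T g)) ->
  (forall g y, P g -> T (r g (psi y)) = r' (T g) y) ->
  forall m (f : {ffun 'I_m -> L} -> H) x, (forall u, P (f u)) ->
  leib_d br' l' r' (fun y => T (f (map_ffun psi y))) x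
  = T (leib_d br l r f (map_ffun psi x)).
Proof.
move=> TL psi_br Tl Tr; elim=> [|m IHm] f x fP; elim/fconsP: x => x y.
  by rewrite map_fcons !leib_d0 (linear_opp TL) Tr.
rewrite map_fcons !leib_dS (linear_sub TL) -IHm //; congr (_ - _).
  rewrite /lie_der (linear_sub TL) Tl // (linear_big TL); congr (_ - _).
  by apply: eq_bigr => i _; rewrite !map_idfun map_upd psi_br ffunE.
by congr (leib_d _ _ _ _ _); apply: funext => y'; rewrite map_fcons.
Qed.

(** * Linear maps between n-Lie algebras as a Leibniz bimodule *)

Section Bimodule.
Variables (K : fieldType) (n : nat).
Hypothesis two_neq0 : 2%:R != 0 :> K.
Variables (N N' : nLieType K n.+1) (phi : {linear N -> N'}).

Definition hom_l (x : LL N) (g : N -> N') : N -> N' :=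
  fun z => ad (phibar phi x) (g z) - g (ad x z).

(** The last term sums the brackets in which one factor phi(y^i) is replaced
    by g(y^i). It makes the right action differ from minus the left action. *)
Definition hom_r (g : N -> N') (y : LL N) : N -> N' :=
  fun z => g (ad y z) - ad (phibar phi y) (g z) - ad (ext_der phi g y) (phi z).

Lemma hom_l_linear x : linear (hom_l x).
Proof.
move=> a g h; apply: funext => z; rewrite /hom_l /= !fctE.
by rewrite ad_linear scalerBr opprD addrACA.
Qed.

Lemma hom_r_linear y : linear (hom_r^~ y).
Proof.
move=> a g h; apply: funext => z; rewrite /hom_r /= !fctE.
rewrite [ext_der _ _ _](ext_der_comb phi g h a y) (ad_linear_l two_neq0) ad_linear.
by rewrite !comb_sub.
Qed.

Lemma hom_l_linear_l g : linear g -> linear (hom_l^~ g).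
Proof.
move=> gL a x y; apply: funext => z; rewrite /hom_l /= !fctE.
rewrite phibar_linear !(ad_linear_l two_neq0) gL.
by rewrite comb_sub.
Qed.

Lemma hom_r_linear_r g : linear g -> linear (hom_r g).
Proof.
move=> gL a x y; apply: funext => z; rewrite /hom_r /= !fctE.
rewrite phibar_linear (ext_der_linear (linearP phi) gL).
rewrite !(ad_linear_l two_neq0) gL.
by rewrite !comb_sub.
Qed.

Lemma hom_l_closed x g : linear g -> linear (hom_l x g).
Proof.
move=> gL a z t; rewrite /hom_l gL !ad_linear gL.
by rewrite comb_sub.
Qed.

Lemma hom_r_closed g y : linear g -> linear (hom_r g y).
Proof.
move=> gL a z t; rewrite /hom_r gL !ad_linear gL (linearP phi) ad_linear.
by rewrite !comb_sub.
Qed.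

(** The n-Lie coboundary is the Leibniz coboundary. Split off the
    first index of each sum over i. These terms, in which x is not an argument
    of f itself, form the Lie derivative along x. The others have x as first
    argument of f: they are the terms of the operator in lower degree, with
    opposite sign because the positions are shifted by one. *)
Lemma delta_leib m (f : prechain N N' m) x :
  delta phi f x = leib_d (@LLbr K n.+1 N) hom_l hom_r f x.
Proof.
have R g y z : hom_r g y z = g (ad y z) - Lact phi y (g z)
    - ext_lift (fun v => \sum_(i < n)
        nbr (snoc (n := n.+1) (upd (map_ffun phi v) i (g (v i))) (phi z))) y.
  rewrite /hom_r LactE //; congr (_ - _).
  rewrite (ext_lift_linear_fun _ _ (ad_linear_l two_neq0 _)).
  apply: eq_ext_lift => v; rewrite (linear_big (ad_linear_l two_neq0 _)).
  by apply: eq_bigr => i _; rewrite ad_wedge.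
apply: funext => z; elim: m => [|m IHm] in f x *; elim/fconsP: x => x y.
  rewrite leib_d0 fctE R /delta !big_ord1 big_pred0_eq add0r.
  rewrite expr0 scale1r expr1 scaleN1r sqrrN expr1n scale1r del_head.
  rewrite (_ : del ord_max _ = y); last first.
    by rewrite -[RHS](del_head x y); congr (del _ _); apply: ord_inj.
  rewrite (_ : ord_max = ord0); last exact: ord_inj.
  by rewrite fcons_head !opprB [RHS]addrC [in RHS](addrC (Lact _ _ _)).
rewrite leib_dS !fctE -IHm.
have bracket_sum :
    \sum_(j < m.+2) \sum_(i < m.+2 | (i < j)%N) (-1) ^+ i.+1 *:
      f (del i (upd (fcons x y) j (LLbr (fcons x y i) (fcons x y j)))) z
  = - polar idfun (@LLbr K n.+1 N x) f y z
    - \sum_(j < m.+1) \sum_(i < m.+1 | (i < j)%N) (-1) ^+ i.+1 *: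
      f (fcons x (del i (upd y j (LLbr (y i) (y j))))) z.
  rewrite big_ord_recl big_pred0_eq add0r /polar fct_sumE -!sumrN -big_split /=.
  apply: eq_bigr => j _; rewrite big_mkcond big_ord_recl /=.
  rewrite fcons_head fcons_tail upd_tail del_head expr1 scaleN1r map_idfun.
  congr (_ + _); rewrite [in RHS]big_mkcond -sumrN /=; apply: eq_bigr => i _.
  rewrite !fcons_tail upd_tail del_tail /bump /= !add1n ltnS; case: ifP => _.
    by rewrite exprS mulN1r scaleNr.
  by rewrite oppr0.
have sign_sum1 F (G : 'I_m.+1 -> N') : (forall i, F (lift ord0 i) = G i) ->
    \sum_(i < m.+2) (-1) ^+ i.+1 *: F i
  = - F ord0 - \sum_(i < m.+1) (-1) ^+ i.+1 *: G i.
  move=> FG; rewrite big_ord_recl -sumrN /= expr1 scaleN1r; congr (_ + _).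
  by apply: eq_bigr => i _; rewrite /bump /= add1n -FG exprS mulN1r scaleNr.
have sign_sum2 F (G : 'I_m.+1 -> N') : (forall i, F (lift ord0 i) = G i) ->
    \sum_(i < m.+2) (-1) ^+ i.+2 *: F i
  = F ord0 - \sum_(i < m.+1) (-1) ^+ i.+2 *: G i.
  move=> FG; rewrite big_ord_recl -sumrN /= sqrrN expr1n scale1r; congr (_ + _).
  by apply: eq_bigr => i _; rewrite /bump /= add1n -FG exprS mulN1r scaleNr.
have lift_max k : @ord_max k.+1 = lift ord0 ord_max by apply: ord_inj.
rewrite /delta bracket_sum.
rewrite (sign_sum1 _ (fun i => f (fcons x (del i y)) (ad (y i) z))); last first.
  by move=> i; rewrite del_tail fcons_tail.
rewrite (sign_sum2 _ (fun i => Lact phi (y i) (f (fcons x (del i y)) z))); last first.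
  by move=> i; rewrite del_tail fcons_tail.
rewrite !fcons_head !del_head.
rewrite lift_max del_tail fcons_tail /lie_der !fctE /hom_l LactE //.
by rewrite exprS mulN1r scaleNr !opprD !addrA [LHS](ACl (5*3*1*2*4*6*7)).
Qed.

Hypothesis phiM : nlie_morphism phi.

Lemma hom_l_br x y g : linear g ->
  hom_l (LLbr x y) g = hom_l x (hom_l y g) - hom_l y (hom_l x g).
Proof.
move=> gL; apply: funext => z; rewrite !fctE /hom_l phibar_LLbr // !ad_LLbr //.
rewrite !(linear_sub (ad_linear _)) (linear_sub gL).
exact: commutator_regroup.
Qed.

(** The action of x on g is X' g - g X, with X = ad x and X' the action on the
    target, so this is ext_der_comm. *)
Lemma ext_der_hom x y g : linear g ->
  LLbr (phibar phi x) (ext_der phi g y)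
  = ext_der phi g (LLbr x y) + ext_der phi (hom_l x g) y.
Proof.
move=> gL; rewrite !LLbrE.
by rewrite (@ext_der_comm _ _ _ _ phi (ad x) (ad (phibar phi x))) //;
  try exact: ad_linear; try exact: linearP; move=> z; apply: phi_ad.
Qed.

Lemma hom_r_br x y g : linear g ->
  hom_l x (hom_r g y) = hom_r (hom_l x g) y + hom_r g (LLbr x y).
Proof.
move=> gL; apply: funext => z.
have key : ad (ext_der phi g (LLbr x y)) (phi z) + ad (ext_der phi (hom_l x g) y) (phi z)
    = ad (phibar phi x) (ad (ext_der phi g y) (phi z))
      - ad (ext_der phi g y) (ad (phibar phi x) (phi z)).
  by rewrite -(linear_add (ad_linear_l two_neq0 _)) -ext_der_hom // ad_LLbr.
rewrite !fctE /hom_r {1 2}/hom_l phibar_LLbr // !ad_LLbr // phi_ad //.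
rewrite !(linear_sub (ad_linear _)) (linear_sub gL).
exact: middle_axiom_regroup key.
Qed.

(** The sum of the left and right actions of x on g is, up to sign,
    h = ad u o phi with u = ext_der phi g x. The right action of y on h is 0:
    since ad u is a derivation of the target bracket, its bracket with y is
    compensated by the sum over the factors of y. *)
Lemma hom_r_der g x y : linear g -> hom_r (hom_r g x) y = - hom_r (hom_l x g) y.
Proof.
move=> gL; set u := ext_der phi g x.
have uL : linear (fun z => ad u (phi z)) by move=> a z t; rewrite (linearP phi) ad_linear.
have -> : hom_r g x = - (hom_l x g + (fun z => ad u (phi z))).
  apply: funext => z; rewrite !fctE /hom_r /hom_l opprD opprB.
  by congr (_ - _).
rewrite (linear_opp (hom_r_linear y)) (linear_add (hom_r_linear y)).
rewrite [X in _ + X](_ : _ = 0) ?addr0 //; apply: funext => z; rewrite /hom_r.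
rewrite -(ext_der_map (linearP phi) (ad_linear u)) -LLbrE ad_LLbr // phi_ad //.
exact: subrr.
Qed.

(** Follows from the middle axiom, as the two actions of x are opposite up to
    elements on which L acts trivially from the right. *)
Lemma hom_br_r x y g : linear g ->
  hom_r g (LLbr x y) = hom_r (hom_r g x) y + hom_l x (hom_r g y).
Proof. by move=> gL; rewrite hom_r_br // hom_r_der // addKr. Qed.

Lemma hom_bimodule :
  leibniz_bimodule (@LLbr K n.+1 N) hom_l hom_r (fun g => linear g).
Proof.
split.
- exact: LLbr_linear.
- exact: LLbr_linear_l.
- exact: LLbr_leibniz.
- exact: hom_l_linear.
- exact: hom_r_linear.
- by move=> a z t; rewrite scaler0 addr0.
- move=> a g h gL hL b z t; rewrite !fctE gL hL.
  by rewrite !scalerDr !scalerA mulrC addrACA.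
- by move=> x g; apply: hom_l_closed.
- by move=> g y; apply: hom_r_closed.
- exact: hom_l_linear_l.
- exact: hom_r_linear_r.
- exact: hom_l_br.
- exact: hom_r_br.
- exact: hom_br_r.
Qed.

End Bimodule.

(** * Skew-symmetry in the last arguments *)

Section SkewMaps.
Variables (K : pzRingType) (V W Z : lmodType K) (k : nat).
Implicit Types g h : {ffun 'I_k -> V} -> W.

Lemma skew_comp (T : W -> Z) g :
  linear T -> skew_symmetric_map g -> skew_symmetric_map (fun w => T (g w)).
Proof. by move=> TL gS s w; rewrite gS (linear_scale TL). Qed.

Lemma skew_sub g h : skew_symmetric_map g -> skew_symmetric_map h ->
  skew_symmetric_map (fun w => g w - h w).
Proof. by move=> gS hS s w; rewrite gS hS scalerBr. Qed.

Lemma skew_sum I (r : seq I) (P : pred I) (G : I -> {ffun 'I_k -> V} -> W) :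
  (forall i, P i -> skew_symmetric_map (G i)) ->
  skew_symmetric_map (fun w => \sum_(i <- r | P i) G i w).
Proof.
by move=> GS s w; rewrite scaler_sumr; apply: eq_bigr => i Pi; apply: GS.
Qed.

End SkewMaps.

Section LastSkew.
Variables (K : fieldType) (n : nat).
Hypothesis two_neq0 : 2%:R != 0 :> K.

Definition front (T : Type) (w : {ffun 'I_n.+1 -> T}) : {ffun 'I_n -> T} :=
  [ffun i => w (widenS i)].

Lemma snoc_front (T : Type) (w : {ffun 'I_n.+1 -> T}) :
  snoc (n := n.+1) (front w) (w ord_max) = w.
Proof.
apply/ffunP; apply: ord_maxP => [i|]; last by rewrite snoc_max.
by rewrite snoc_widen ffunE.
Qed.

Lemma front_snoc (T : Type) (v : {ffun 'I_n -> T}) z : front (snoc (n := n.+1) v z) = v.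
Proof. by apply/ffunP=> i; rewrite ffunE snoc_widen. Qed.

(** Turns the skew-symmetry clause of is_cochain into skew-symmetry of a
    function on families of n vectors, to which the lemmas on polar apply. *)
Definition at_last (N N' : nLieType K n.+1) m (f : prechain N N' m) x j
    (w : {ffun 'I_n.+1 -> N}) : N' :=
  f (upd x j (wedge (front w))) (w ord_max).

Lemma at_last_snoc (N N' : nLieType K n.+1) m (f : prechain N N' m) x j
    (v : {ffun 'I_n -> N}) z :
  at_last f x j (snoc (n := n.+1) v z) = f (upd x j (wedge v)) z.
Proof. by rewrite /at_last front_snoc snoc_max. Qed.

Definition last_skew (N N' : nLieType K n.+1) m (f : prechain N N' m) : Prop :=
  forall x (j : 'I_m), j.+1 = m -> skew_symmetric_map (at_last f x j).

Lemma is_cochainE (N N' : nLieType K n.+1) m (f : prechain N N' m) :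
  is_cochain f <->
  [/\ multilinear_map f, forall x, linear (f x) & last_skew f].
Proof.
split=> [[fM fL fS]|[fM fL fS]].
  split=> [v i a x y|//|x j jm s w]; first by apply: funext => z; apply: (fM z).
  by apply: fS jm _ _ _ _ _ _; rewrite !snoc_front.
split=> [z v i a x y|//|x j jm s v v' z z' E]; first by rewrite fM.
by rewrite -!at_last_snoc E fS.
Qed.

Variables (N N' : nLieType K n.+1) (phi : {linear N -> N'}).

Let d m := @leib_d K (LL N) (N -> N') (@LLbr K n.+1 N) (hom_l phi) (hom_r phi) m.

Lemma hom_r_wedge (g : N -> N') (v : {ffun 'I_n -> N}) z : linear g ->
  hom_r phi g (wedge v) z
  = g (nbr (snoc (n := n.+1) v z)) - polar phi g nbr (snoc (n := n.+1) v z).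
Proof.
move=> gL; rewrite polar_nbr_snoc [X in _ - X]addrC opprD addrA.
rewrite /hom_r [phibar _ _](ext_map_wedge _ (linearP phi)) !ad_wedge //; congr (_ - _).
rewrite ext_der_wedge //; last exact: linearP.
rewrite (linear_big (ad_linear_l two_neq0 _)).
by apply: eq_bigr => i _; rewrite ad_wedge.
Qed.

(** At the last entry the Lie derivative along x of the cochain, plus the term
    f(..., ad x z) of the action of x on linear maps, is the derivation action
    of ad x on all n skew arguments. The remaining terms leave these arguments
    alone. *)
Lemma lie_der_skew m x (f : prechain N N' m) : multilinear_map f -> last_skew f ->
  last_skew (lie_der (@LLbr K n.+1 N) (hom_l phi) x f).
Proof.
move=> fM fS y j jm.
have E w : at_last (lie_der (@LLbr K n.+1 N) (hom_l phi) x f) y j w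
  = ad (phibar phi x) (at_last f y j w) - polar idfun (ad x) (at_last f y j) w
    - \sum_(k < m | k != j) at_last f (upd y k (LLbr x (y k))) j w.
  elim/snocP: w => v z; rewrite !at_last_snoc /lie_der /polar (bigD1 j) //=.
  rewrite !map_idfun upd_same upd_upd !fctE fct_sumE /hom_l big_ord_recr /=.
  rewrite snoc_max upd_max at_last_snoc !opprD !addrA [in RHS]addrAC.
  congr (_ - _ - _ - _).
    rewrite LLbrE ext_der_wedge //; last exact: ad_linear.
    have FL : linear (fun t => f (upd y j t) z) by move=> a t u; rewrite fM.
    rewrite (linear_big FL); apply: eq_bigr => i _.
    by rewrite map_idfun -/(widenS i) snoc_widen upd_widen at_last_snoc.
  apply: eq_bigr => k nkj; rewrite at_last_snoc upd_other // upd_comm //.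
  by rewrite eq_sym.
rewrite (funext E); apply: skew_sub; last first.
  by apply: skew_sum => k _; apply: fS.
apply: skew_sub; last by apply: polar_skew; apply: fS.
by apply: skew_comp; [apply: ad_linear | apply: fS].
Qed.

(** In degree 0 the three terms of the right action add up to one polarization
    of the bracket minus the composite of f with the bracket. In higher degree
    the last argument is not the first one and Cartan's formula applies. *)
Lemma leib_d_skew m (f : prechain N N' m) :
  multilinear_map f -> (forall u, linear (f u)) -> last_skew f -> last_skew (d f).
Proof.
elim: m => [|m IHm] in f * => fM fL fS x j; elim/fconsP: x => x y.
  have -> : j = ord0 by apply: ord_inj; case: j => [[]].
  move=> _.
  have E w : at_last (d f) (fcons x y) ord0 w = polar phi (f y) nbr w - f y (nbr w).
    elim/snocP: w => v z; rewrite at_last_snoc upd_head /d leib_d0 fctE.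
    by rewrite hom_r_wedge // opprB.
  rewrite (funext E); apply: skew_sub.
    by apply: polar_skew; apply: nbr_skew.
  by apply: skew_comp; [|apply: nbr_skew].
case: (unliftP ord0 j) => [h ->|->] // jm.
have hm : h.+1 = m.+1 by apply: succn_inj; exact: jm.
have E w : at_last (d f) (fcons x y) (lift ord0 h) w
  = at_last (lie_der (@LLbr K n.+1 N) (hom_l phi) x f) y h w
    - at_last (d (fun y' => f (fcons x y'))) y h w.
  by rewrite /at_last upd_tail /d leib_dS.
rewrite (funext E); apply: skew_sub.
  by apply: lie_der_skew.
apply: IHm => //; first exact: multilinear_cons.
move=> y' h' hm' s w; have := fS (fcons x y') (lift ord0 h') _ s w.
rewrite /at_last !upd_tail; apply.
by rewrite /= /bump /= add1n hm'.
Qed.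

End LastSkew.

(** * The coboundary operator of n-Lie algebras *)

Section Coboundary.
Variables (K : fieldType) (n : nat).
Hypothesis two_neq0 : 2%:R != 0 :> K.

Lemma is_cochain_comb (N N' : nLieType K n.+1) m a (f g : prechain N N' m) :
  is_cochain f -> is_cochain g -> is_cochain (a *: f + g).
Proof.
move=> [fM fL fS] [gM gL gS]; split.
- move=> z v i b x y; rewrite !fctE fM gM.
  by rewrite !scalerDr !scalerA mulrC addrACA.
- move=> x b z t; rewrite !fctE fL gL.
  by rewrite !scalerDr !scalerA mulrC addrACA.
move=> x j jm s v v' z z' E; rewrite !fctE.
rewrite (fS x j jm _ _ _ _ _ E) (gS x j jm _ _ _ _ _ E).
by rewrite !scalerDr !scalerA mulrC.
Qed.

Lemma is_cochain0 (N N' : nLieType K n.+1) m : is_cochain (0 : prechain N N' m).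
Proof.
have Z x z : (0 : prechain N N' m) x z = 0 by [].
split=> [z v i a x y|x a z t|x j jm s v v' z z' _].
- by rewrite [LHS]Z [X in a *: X]Z [X in _ + X]Z scaler0 addr0.
- by rewrite [LHS]Z [X in a *: X]Z [X in _ + X]Z scaler0 addr0.
- by rewrite [LHS]Z [X in _ *: X]Z scaler0.
Qed.

Section Delta.
Variables (N N' : nLieType K n.+1) (phi : {linear N -> N'}).

Lemma delta_leibE m : @delta K n.+1 N N' phi m
  = @leib_d K (LL N) (N -> N') (@LLbr K n.+1 N) (hom_l phi) (hom_r phi) m.
Proof. by apply: funext => f; apply: funext => x; apply: delta_leib. Qed.

Hypothesis phiM : nlie_morphism phi.

Lemma delta_linear m : linear (@delta K n.+1 N N' phi m).
Proof.
move=> a f g; rewrite delta_leibE; apply: funext => x.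
exact: (leib_d_comb (hom_bimodule two_neq0 phiM)).
Qed.

Lemma delta_cochain m (f : prechain N N' m) : is_cochain f -> is_cochain (delta phi f).
Proof.
move/is_cochainE => [fM fL fS]; apply/is_cochainE; rewrite delta_leibE; split.
- exact: (leib_d_multilinear (hom_bimodule two_neq0 phiM)).
- by move=> x; apply: (leib_d_closed (hom_bimodule two_neq0 phiM)).
- exact: leib_d_skew.
Qed.

Lemma delta_delta m (f : prechain N N' m) : is_cochain f -> delta phi (delta phi f) = 0.
Proof.
move/is_cochainE => [fM fL _]; rewrite !delta_leibE; apply: funext => x.
exact: (leib_dd (hom_bimodule two_neq0 phiM)).
Qed.

Lemma phibar_idfun (M : nLieType K n.+1) (x : LL M) : phibar idfun x = x.
Proof.
move: x; apply: ext_linear_eq => // [|v]; first exact: (ext_map_linear (linearP idfun)).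
by rewrite [LHS](ext_map_wedge _ (linearP idfun)) map_idfun.
Qed.

(** Composition with phi is a morphism of bimodules because phi preserves
    brackets. In the last term of the right action phi moves inside the wedge by
    ext_map_der. *)
Lemma delta_postcomp m (f : prechain N N m) : is_cochain f ->
  delta phi (fun x z => phi (f x z)) = fun x z => phi (delta idfun f x z).
Proof.
move/is_cochainE => [_ fL _].
rewrite delta_leibE (_ : delta idfun f
  = leib_d (@LLbr K n.+1 N) (hom_l idfun) (hom_r idfun) f); last first.
  by apply: funext => x; apply: (delta_leib _ idfun).
apply: funext => x.
have := @leib_d_natural K (LL N) (LL N) (N -> N) (N -> N') (@LLbr K n.+1 N)
  (hom_l idfun) (hom_r idfun) (@LLbr K n.+1 N) (hom_l phi) (hom_r phi) idfun
  (fun g z => phi (g z)) (fun g => linear g).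
rewrite -[x in RHS]map_idfun => <- //.
- by congr (leib_d _ _ _ _ _); apply: funext => y; rewrite map_idfun.
- by move=> a g h; apply: funext => z; rewrite !fctE (linearP phi).
- move=> y g gL; apply: funext => z.
  by rewrite /hom_l phibar_idfun (linear_sub (linearP phi)) (phi_ad two_neq0 phiM).
move=> g y gL; apply: funext => z.
rewrite /hom_r phibar_idfun !(linear_sub (linearP phi)) !(phi_ad two_neq0 phiM).
by rewrite [phibar phi (ext_der _ _ _)](ext_map_der (linearP phi) gL).
Qed.

(** Composition with phi on the right is compatible with the actions along
    phibar, since phi intertwines ad x and ad (phibar x). In the last term of
    the right action this is ext_der_map. *)
Lemma delta_precomp m (f : prechain N' N' m) : is_cochain f ->
  delta phi (fun x z => f (map_ffun (phibar phi) x) (phi z))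
  = fun x z => delta idfun f (map_ffun (phibar phi) x) (phi z).
Proof.
move/is_cochainE => [_ fL _].
rewrite delta_leibE (_ : delta idfun f
  = leib_d (@LLbr K n.+1 N') (hom_l idfun) (hom_r idfun) f); last first.
  by apply: funext => x; apply: (delta_leib _ idfun).
apply: funext => x.
apply: (@leib_d_natural K (LL N') (LL N) (N' -> N') (N -> N') (@LLbr K n.+1 N')
  (hom_l idfun) (hom_r idfun) (@LLbr K n.+1 N) (hom_l phi) (hom_r phi) (phibar phi)
  (fun g z => g (phi z)) (fun g => linear g)) => //.
- exact: phibar_LLbr.
- move=> y g gL; apply: funext => z.
  by rewrite /hom_l phibar_idfun phi_ad.
move=> g y gL; apply: funext => z.
rewrite /hom_r phibar_idfun phi_ad //.
by rewrite [ext_der _ _ (phibar _ _)](ext_der_map (linearP phi) gL).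
Qed.

Lemma is_cochain_postcomp m (f : prechain N N m) : is_cochain f ->
  is_cochain ((fun x z => phi (f x z)) : prechain N N' m).
Proof.
move=> [fM fL fS]; split=> [z v i a x y|x a z t|x j jm s v v' z z' E].
- by rewrite fM (linearP phi).
- by rewrite fL (linearP phi).
- by rewrite (fS _ _ jm _ _ _ _ _ E) (linear_scale (linearP phi)).
Qed.

Lemma is_cochain_precomp m (f : prechain N' N' m) : is_cochain f ->
  is_cochain ((fun x z => f (map_ffun (phibar phi) x) (phi z)) : prechain N N' m).
Proof.
move=> [fM fL fS]; split=> [z v i a x y|x a z t|x j jm s v v' z z' E].
- by rewrite !map_upd phibar_linear fM.
- by rewrite (linearP phi) fL.
- rewrite !map_upd ![phibar phi _](ext_map_wedge _ (linearP phi)).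
  apply: (fS _ _ jm); rewrite -!map_snoc E.
  by apply/ffunP=> i; rewrite !ffunE.
Qed.

End Delta.
End Coboundary.

(** * The complex of a morphism *)

(** Stated for an explicit product, where the componentwise operations are
    found by computation. *)
Lemma pair_comb (K : pzRingType) (U V W : lmodType K) a (c c' : (U * V * W)%type) :
  a *: c + c' = (a *: c.1.1 + c'.1.1, a *: c.1.2 + c'.1.2, a *: c.2 + c'.2).
Proof. by []. Qed.

Section MorphismComplex.
Variables (K : fieldType) (n : nat).
Hypothesis two_neq0 : 2%:R != 0 :> K.
Variables (N N' : nLieType K n.+1) (phi : {linear N -> N'}).
Hypothesis phiM : nlie_morphism phi.

Lemma idfun_morphism (M : nLieType K n.+1) : nlie_morphism (@idfun M).
Proof. by move=> x; rewrite map_idfun. Qed.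

Definition defect m (c : morph_prechain N N' m) : prechain N N' m :=
  fun x z => phi (c.1.1 x z) - c.1.2 (map_ffun (phibar phi) x) (phi z).

Lemma morph_deltaE m (c : morph_prechain N N' m) :
  morph_delta phi c = (delta idfun c.1.1, delta idfun c.1.2,
    delta_pred phi c.2 + (-1) ^+ m *: defect c).
Proof. by []. Qed.

Lemma morph_prechain_comb m a (c c' : morph_prechain N N' m) :
  a *: c + c' = (a *: c.1.1 + c'.1.1, a *: c.1.2 + c'.1.2, a *: c.2 + c'.2).
Proof. exact: pair_comb. Qed.

Lemma delta_pred_linear m : linear (@delta_pred K n.+1 N N' phi m).
Proof.
case: m => [|m] a f g /=; first by rewrite scaler0 addr0.
exact: delta_linear.
Qed.

Lemma delta_pred_cochain m (f : prechain_pred N N' m) :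
  is_cochain_pred f -> is_cochain (delta_pred phi f).
Proof. by case: m f => [|m] f fC; [apply: is_cochain0 | apply: delta_cochain]. Qed.

Lemma delta_delta_pred m (f : prechain_pred N N' m) :
  is_cochain_pred f -> delta phi (delta_pred phi f) = 0.
Proof.
case: m f => [|m] f fC /=; last exact: delta_delta.
exact: (linear_zero (delta_linear two_neq0 phiM (m := 0))).
Qed.

Lemma defectE m (c : morph_prechain N N' m) :
  defect c = (fun x z => phi (c.1.1 x z))
    - (fun x z => c.1.2 (map_ffun (phibar phi) x) (phi z)).
Proof. by []. Qed.

(** The defect is the difference of a pushforward and a pullback, and the
    coboundary operator is natural for both. *)
Lemma delta_defect m (c : morph_prechain N N' m) : is_morph_cochain c ->
  delta phi (defect c) = defect (morph_delta phi c).
Proof.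
case=> c1 c2 _; rewrite !defectE (linear_sub (delta_linear two_neq0 phiM (m := _))).
by rewrite delta_postcomp // delta_precomp.
Qed.

Lemma defect_cochain m (c : morph_prechain N N' m) : is_morph_cochain c ->
  is_cochain (defect c).
Proof.
case=> c1 c2 _; rewrite defectE -scaleN1r addrC; apply: is_cochain_comb.
  exact: is_cochain_precomp.
exact: is_cochain_postcomp.
Qed.

Lemma defect_linear m : linear (@defect m).
Proof.
move=> a c c'; rewrite morph_prechain_comb; apply: funext => x; apply: funext => z.
by rewrite /defect /= !fctE (linearP phi) comb_sub.
Qed.

(** In the third component the coboundary of the defect of c appears with the
    sign (-1)^m, and the defect of the coboundary of c with the opposite
    sign. *)
Lemma morph_delta_delta m (c : morph_prechain N N' m) : is_morph_cochain c ->
  morph_delta phi (morph_delta phi c) = 0.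
Proof.
move=> cC; have [c1 c2 c3] := cC.
rewrite morph_deltaE -(delta_defect cC) /= exprS mulN1r scaleNr addrC.
rewrite (linear_add (delta_linear two_neq0 phiM (m := _))) delta_delta_pred // add0r.
rewrite (linear_scale (delta_linear two_neq0 phiM (m := _))) addNr.
by rewrite !(delta_delta two_neq0 (@idfun_morphism _)).
Qed.

Lemma morph_complex :
  cochain_complex (fun m => @is_morph_cochain K n.+1 N N' m)
                  (fun m => @morph_delta K n.+1 N N' phi m).
Proof.
split=> [m|m a c c'|m c|m a c c' _ _|m c].
- by split; [apply: is_cochain0..|case: m => // m; apply: is_cochain0].
- case=> [c1 c2 c3] [d1 d2 d3]; rewrite morph_prechain_comb.
  split; [exact: (is_cochain_comb a c1 d1)|exact: (is_cochain_comb a c2 d2)|].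
  case: m c c' {c1 c2 d1 d2} c3 d3 => // m c c' c3 d3.
  exact: (is_cochain_comb a c3 d3).
- move=> cC; have [c1 c2 c3] := cC; split.
  + exact: (delta_cochain two_neq0 (@idfun_morphism _)).
  + exact: (delta_cochain two_neq0 (@idfun_morphism _)).
  rewrite /= addrC; apply: is_cochain_comb; first exact: defect_cochain.
  exact: delta_pred_cochain.
- rewrite !morph_deltaE defect_linear !morph_prechain_comb /=.
  rewrite !(delta_linear two_neq0 (@idfun_morphism _)) delta_pred_linear.
  by congr (_, _, _); rewrite !scalerDr !scalerA (mulrC a) addrACA.
- exact: morph_delta_delta.
Qed.

End MorphismComplex.

Theorem proposition3p1 (K : closedFieldType) (charK : [pchar K] =i pred0)
    (n : nat) (n_ge2 : (2 <= n)%N) (N N' : nLieType K n)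
    (phi : {linear N -> N'}) (phiM : nlie_morphism phi) :
  (forall (m : nat) (c : morph_prechain N N' m), is_morph_cochain c ->
     morph_delta phi (morph_delta phi c) = 0)
  /\ cochain_complex (fun m => @is_morph_cochain K n N N' m)
                     (fun m => @morph_delta K n N N' phi m).
Proof.
case: n n_ge2 N N' phi phiM => // n _ N N' phi phiM.
have two_neq0 : 2%:R != 0 :> K by have := charK 2; rewrite !inE /= => /negbT.
by split; [apply: morph_delta_delta | apply: morph_complex].
Qed.
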